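(* Let $I$ be a countable index set with $|I| \geq 2$ and let $\mathcal{C} = \{H_i \mid i \in I\}$ be a family of countable nontrivial groups, at least one of which has at least $3$ elements (the groups may be isomorphic for different values of the index). Then there exist a simple group $S$ that is generated by two elements and, for each $i \in I$, an injective homomorphism $\varphi_i : H_i \to S$, such that for all $i, j \in I$ with $i \neq j$ and $|H_j| \geq 3$, the group $S$ is generated by $\varphi_i(H_i) \cup \varphi_j(H_j)$.
   Context: Countable means finite or countably infinite. The image $\varphi_i(H_i)$ is the copy of $H_i$ in $S$; the embeddings $\varphi_i$ are fixed once, independently of the pair $(i,j)$ considered. *)

(* Defs.v *)
From HB Require Import structures.
From mathcomp Require Import all_boot.
From mathcomp Require Import boolp classical_sets functions cardinality.

Set Implicit Arguments.
Unset Strict Implicit.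
Unset Printing Implicit Defensive.

Local Open Scope classical_set_scope.
Local Open Scope group_scope.

Definition subgroup (G : groupType) (K : set G) : Prop := group_closed [in K].

Definition normal_subgroup (G : groupType) (N : set G) : Prop :=
  subgroup N /\ forall x y : G, N x -> N (x ^ y).

Definition simple_group (G : groupType) : Prop :=
  (exists x : G, x <> 1) /\
  forall N : set G, normal_subgroup N -> N = [set 1] \/ N = [set: G].

Definition subgroup_generated (G : groupType) (A : set G) : set G :=
  smallest (@subgroup G) A.

Definition generates (G : groupType) (A : set G) : Prop :=
  subgroup_generated A = [set: G].

(* Main.v *)
Require Import Defs.
From HB Require Import structures.
From mathcomp Require Import all_boot.
From mathcomp Require Import boolp classical_sets functions cardinality.
From mathcomp Require Import fingroup zmodp zify.

Set Implicit Arguments.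
Unset Strict Implicit.
Unset Printing Implicit Defensive.

(** The group [S] is a quotient of the free product of the [H i] and of three
further cyclic groups of order 3.  Whenever [x] lies in one factor, [y] and [z]
are distinct elements of a second one, [g] lies in a third one and all four are
nontrivial, a relation [g = w] is imposed, where [w] is a product of blocks
[b^-1 x b x] with [b] equal to [y] or [z].  These relations do two things.
- A subgroup that contains the factors of [x] and of [y], [z] contains [g].
  Hence two factors generate [S] as soon as the second has three elements
  ([two_factors_generate]); two of the added cyclic groups do so, and [S] is
  generated by two elements.
- If [x] becomes trivial, the blocks cancel and so does [g].  Hence a congruence
  on words that contains the relations and kills one nontrivial letter kills all
  letters ([trivial_all]).  Take a congruence that is maximal among those that
  contain the relations and do not kill one chosen letter
  ([maximal_congruence]).  It kills no letter, so the factors embed; and a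
  nontrivial normal subgroup of the quotient would give a larger congruence,
  so the quotient is simple ([quotient_simple]).

It remains to see that the relations themselves kill no letter.  This is where
the choice of the blocks matters: [y] stands in the blocks whose numbers are
the values [mark n s = 2 Q (n + 1) s + s ^ 2], where [n] is a code of the
quadruple, and [z] in all others.  Two successive marks of one relator have a
distance that occurs nowhere else, neither in this relator nor in another one,
so a hundredth part of a relator determines the relator, the place and the
direction of reading ([agree_eq]).

From this small cancellation condition one could argue with van Kampen diagrams.
Instead, a set is constructed on which every factor acts freely and on which
every relator acts as the identity ([act_free], [trace_relator]); a letter that
acts without fixed points is not killed.  The set grows in countably many
rounds, starting from one point.  Each round adds a free orbit of a factor at
every point where that factor does not act yet.  When at least half of a relator
has been traced from [x] to [y] and cannot be continued at either end, the round
also supplies the missing part, as two branches that grow out of [x] and [y] and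
are glued at their tips.  The invariant that keeps this going is that a path
which traces a little more than half of a relator closes up ([grow_close]).  It
is preserved because the new part consists of trees and of glued branches: a
path of more than a few pieces there has to follow a branch for at least one
piece, and is then, by small cancellation, part of the relator for which the
branch was added. *)

(** * Relators and partial actions *)

Section Letters.
Context (I : Type) (H : I -> groupType).

Definition letter := {i : I & H i}.
Definition linv (l : letter) : letter := existT _ (tag l) (tagged l)^-1%g.

Lemma linvK : involutive linv.
Proof. by case=> i h; rewrite /linv /= invgK. Qed.

Lemma letter_inj i (a b : H i) : existT H i a = existT H i b -> a = b.
Proof.
move=> e; have := projT2_eq e.
by rewrite (Prop_irrelevance (projT1_eq e) erefl).
Qed.

Lemma letter_cons_inj i (a b : H i) (v w : seq letter) :
  existT H i a :: v = existT H i b :: w -> a = b /\ v = w.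
Proof.
move=> e; split; last by have := congr1 behead e.
exact: letter_inj (congr1 (head (existT H i a)) e).
Qed.

(** A set of cyclically reduced relators that is closed under inversion and
cyclic shift, described by its phases: a phase is a place on a relator together
with a direction of reading.  The letter read next is [label], [succ] is the phase
after it, [back] turns around on the spot, and [sgn] tells the two directions
apart.  Small cancellation is [piece_agree] together with [small_pieces]. *)
Record relatorSystem := RelatorSystem {
  phase :> Type;
  succ : phase -> phase;
  back : phase -> phase;
  label : phase -> letter;
  len : phase -> nat;
  piece : phase -> nat;
  sgn : phase -> bool;
  backK : involutive back;
  succ_back : forall f, succ (back (succ f)) = back f;
  label_back : forall f, label (back (succ f)) = linv (label f);
  label_neq1 : forall f, tagged (label f) <> 1%g;
  label_alt : forall f, tag (label (succ f)) <> tag (label f);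
  len_succ : forall f, len (succ f) = len f;
  len_back : forall f, len (back f) = len f;
  piece_succ : forall f, piece (succ f) = piece f;
  piece_back : forall f, piece (back f) = piece f;
  sgn_succ : forall f, sgn (succ f) = sgn f;
  sgn_back : forall f, sgn (back f) = ~~ sgn f;
  succ_period : forall f, iter (len f) succ f = f;
  piece_gt0 : forall f, 0 < piece f;
  small_pieces : forall f, 100 * piece f <= len f;
  piece_agree : forall f g,
    (forall k, k < piece f -> label (iter k succ f) = label (iter k succ g)) -> f = g
}.
End Letters.
Arguments succ {I H r} _.
Arguments back {I H r} _.
Arguments label {I H r} _.
Arguments len {I H r} _.
Arguments piece {I H r} _.
Arguments sgn {I H r} _.

Section Development.
Context (I : Type) (H : I -> groupType) (R : relatorSystem H).
Local Notation letter := (letter H).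
Implicit Types (f g : R) (i : I) (l : letter).

Lemma back_iter k f : iter k succ (back (iter k succ f)) = back f.
Proof.
elim: k f => [|k IH] f //; rewrite iterSr (iterS k succ f).
by rewrite succ_back IH.
Qed.

Lemma len_iter k f : len (iter k succ f) = len f.
Proof. by elim: k => //= k <-; rewrite len_succ. Qed.
Lemma piece_iter k f : piece (iter k succ f) = piece f.
Proof. by elim: k => //= k <-; rewrite piece_succ. Qed.
Lemma sgn_iter k f : sgn (iter k succ f) = sgn f.
Proof. by elim: k => //= k <-; rewrite sgn_succ. Qed.

Lemma back_period k f : k <= len f ->
  iter (len f - k) succ (back f) = back (iter k succ f).
Proof.
move=> lek; rewrite -(back_iter k f) -iterD subnK //.
have {1}-> : len f = len (back (iter k succ f)) by rewrite len_back len_iter.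
exact: succ_period.
Qed.

(** The last letter read comes first: this is the order in which the letters
pile up in the name of a point at the end of a branch. *)
Fixpoint labels k f : seq letter :=
  if k is k'.+1 then label (iter k' succ f) :: labels k' f else [::].

Lemma size_labels k f : size (labels k f) = k.
Proof. by elim: k => //= k ->. Qed.

Lemma labels_nth k j f g : labels k f = labels k g -> j < k ->
  label (iter j succ f) = label (iter j succ g).
Proof.
elim: k => [|k IH] //= [e1 e2]; rewrite ltnS leq_eqVlt => /orP[/eqP-> //|].
exact: IH.
Qed.

Lemma labels_piece k f g : labels k f = labels k g -> piece f <= k -> f = g.
Proof.
move=> e le; apply: piece_agree => j ltj; apply: labels_nth e _.
exact: leq_trans ltj le.
Qed.

Lemma labels_split a b f g w : size w = a ->
  labels (b + a) f = labels b g ++ w ->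
  labels a f = w /\ labels b (iter a succ f) = labels b g.
Proof.
move=> sw; elim: b => [|b IH] //=.
by case=> e1 /IH[-> ->]; split=> //; rewrite -iterD e1.
Qed.

Lemma labels_eq_size k k' f g : labels k f = labels k' g -> k = k'.
Proof. by move/(congr1 size); rewrite !size_labels. Qed.

(** [(n, w) :: y] is the name of a point that round [n] creates at the end of a
branch [w] growing out of the older point [y]. *)
Definition point := seq (nat * seq letter).
(** [E i h p q] means that [h], an element of the factor [i], moves [p] to [q]. *)
Definition cellrel := forall i, H i -> point -> point -> Prop.
Implicit Types (E : cellrel) (p q : point).

(** Each factor acts freely on some of the points.  An orbit of a single factor is
called a cell. *)
Record cells E : Prop := Cells {
  cell_total : forall i h h' p q, E i h p q -> exists q', E i h' p q';
  cell_mul : forall i h h' p q s, E i h p q -> E i h' q s -> E i (h' * h)%g p s;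
  cell_fun : forall i h p q q', E i h p q -> E i h p q' -> q = q';
  cell_inv : forall i h p q, E i h p q -> E i h^-1%g q p;
  cell_free : forall i h p, E i h p p -> h = 1%g
}.

Definition active E i p := E i 1%g p p.
Definition step E l p q := E (tag l) (tagged l) p q.

Fixpoint run E k p f q : Prop :=
  if k is k'.+1 then exists s, step E (label f) p s /\ run E k' s (succ f) q
  else p = q.

Definition closed E p f := run E (len f) p f p.

Section Cells.
Context (E : cellrel) (cE : cells E).
Arguments E : clear implicits.

Lemma cell_active i h p q : E i h p q -> active E i p.
Proof.
move=> e; have e' := cell_inv cE e.
by have := cell_mul cE e e'; rewrite mulVg.
Qed.
Lemma cell_activeR i h p q : E i h p q -> active E i q.
Proof. by move/(cell_inv cE)/cell_active. Qed.
Lemma active_cell i h p : active E i p -> exists q, E i h p q.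
Proof. exact: cell_total. Qed.

Lemma step_inv l p q : step E l p q -> step E (linv l) q p.
Proof. exact: cell_inv. Qed.

Lemma run_det k p f q q' : run E k p f q -> run E k p f q' -> q = q'.
Proof.
elim: k p f => [|k IH] p f /=; first by move=> -> ->.
move=> [s [e r]] [s' [e' r']].
by rewrite -(cell_fun cE e e') in r'; exact: IH r r'.
Qed.
End Cells.

Lemma run_add E a b p f q :
  run E (a + b) p f q <->
  exists s, run E a p f s /\ run E b s (iter a succ f) q.
Proof.
elim: a p f => [|a IH] p f /=.
  by split=> [r|[s [-> //]]]; exists p.
split.
  move=> [s [e /IH[t [r1 r2]]]]; exists t; split; first by exists s.
  by move: r2; rewrite -iterSr.
move=> [t [[s [e r1]] r2]]; exists s; split=> //; apply/IH.
by exists t; split=> //; rewrite -iterSr.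
Qed.

Lemma run1 E p f q : step E (label f) p q -> run E 1 p f q.
Proof. by move=> e; exists q. Qed.

Lemma run_rcons E k p f s q :
  run E k p f s -> step E (label (iter k succ f)) s q -> run E k.+1 p f q.
Proof. by move=> r e; rewrite -addn1; apply/run_add; exists s; split=> //; apply: run1. Qed.

Lemma run_rcons_inv E k p f q : run E k.+1 p f q ->
  exists s, run E k p f s /\ step E (label (iter k succ f)) s q.
Proof.
by rewrite -addn1 => /run_add[s [r [t [e /= <-]]]]; exists s.
Qed.

Lemma run_prefix E a b p f q : a <= b -> run E b p f q -> exists s, run E a p f s.
Proof. by move=> /subnK<-; rewrite addnC => /run_add[s [r _]]; exists s. Qed.

Lemma run_sub E E' k p f q :
  (forall i h p q, E i h p q -> E' i h p q) -> run E k p f q -> run E' k p f q.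
Proof.
move=> sub; elim: k p f => [|k IH] p f //= [s [e r]].
by exists s; split; [exact: sub | exact: IH].
Qed.

Lemma run_back E k p f q : cells E -> run E k p f q ->
  run E k q (back (iter k succ f)) p.
Proof.
move=> cE; elim: k p f => [|k IH] p f /= => [-> //|[s [e /IH r]]].
apply: (run_rcons (s := s)); first by rewrite -iterS iterSr.
rewrite -iterS iterSr back_iter label_back; exact: step_inv.
Qed.

(** The path of a closed relator can be read from any of its points. *)
Lemma closed_run E k p f q : cells E -> run E k p f q ->
  closed E p f <-> closed E q (iter k succ f).
Proof.
move=> cE; elim: k p f => [|k IH] p f /= => [-> //|[s [e r]]].
rewrite -iterS iterSr -(IH _ _ r) /closed len_succ.
case: (len f) (succ_period f) => [|n pf]; first by [].
split=> [[s' [e' r']]|].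
  apply: (run_rcons (s := p)); last by rewrite -iterSr pf.
  by rewrite (cell_fun cE e e').
move/run_rcons_inv=> [p' [r' e']]; exists s; split=> //.
move: e'; rewrite -iterSr pf => e'.
have -> // : p = p'.
exact: (cell_fun cE (step_inv cE e) (step_inv cE e')).
Qed.

Lemma closed_back E p f : cells E -> closed E p f -> closed E p (back f).
Proof.
move=> cE r; have := run_back cE r.
by rewrite succ_period /closed len_back.
Qed.

End Development.

(** * An action in which every relator is trivial *)

Section Round.
Context (I : Type) (H : I -> groupType) (R : relatorSystem H).
Local Notation letter := (letter H).
Local Notation point := (point H).
Implicit Types (f g : R) (i : I) (l : letter) (p q x y : point) (w : seq letter).

Definition half_len f := (len f)./2.
(** The length from which the invariant makes a run close up.  The excess over one
half is for runs whose two ends wander into new cells: each wanders through at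
most two pieces and a few letters. *)
Definition closing_len f := half_len f + 4 * piece f + 10.

Lemma half_len_iter k f : half_len (iter k succ f) = half_len f.
Proof. by rewrite /half_len len_iter. Qed.
Lemma closing_len_back f : closing_len (back f) = closing_len f.
Proof. by rewrite /closing_len /half_len len_back piece_back. Qed.
Lemma half_len_back f : half_len (back f) = half_len f.
Proof. by rewrite /half_len len_back. Qed.

(** Names carry the number of their round, so the points that exist before round
[n] can be told by their names. *)
Definition live n (p : point) := all (fun a => a.1 < n) p.

Definition first_tag_neq i w := if w is l :: _ then tag l <> i else True.

Context (E : cellrel H) (n : nat).
Arguments E : clear implicits.
Context (cE : cells E) (liveE : forall i h p q, E i h p q -> live n p).
Context (closeE : forall f p q, run E (closing_len f) p f q -> closed E p f).

Lemma liveER i h p q : E i h p q -> live n q.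
Proof. by move/(cell_inv cE)/liveE. Qed.
Lemma live_active i p : active E i p -> live n p.
Proof. exact: liveE. Qed.

(** If a path of the relator leads from [y] in direction [back f] to a point [x],
[m] letters away, this is the phase at [x] that continues the path. *)
Definition opposite f m : R := iter m succ (back f).

(** At least half of a relator has been traced, between [x] and [y], and no end can
be prolonged.  The rest has to be supplied: it is read from [y] along [f], or
from [x] along [opposite f m]. *)
Definition pending y f m x :=
  [/\ ~ active E (tag (label f)) y, run E m y (back f) x,
      ~ active E (tag (label (opposite f m))) x & half_len f <= m].

Lemma oppositeK f m : opposite (opposite f m) m = f.
Proof. by rewrite /opposite back_iter backK. Qed.
Lemma len_opposite f m : len (opposite f m) = len f.
Proof. by rewrite len_iter len_back. Qed.
Lemma piece_opposite f m : piece (opposite f m) = piece f.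
Proof. by rewrite piece_iter piece_back. Qed.
Lemma sgn_opposite f m : sgn (opposite f m) = ~~ sgn f.
Proof. by rewrite sgn_iter sgn_back. Qed.

Lemma opposite_iter f m j : m + j <= len f ->
  iter j succ (opposite f m) = back (iter (len f - m - j) succ f).
Proof.
move=> le; rewrite /opposite -iterD -back_period ?leq_subr //; last by lia.
by congr (iter _ _ _); lia.
Qed.

Lemma pending_sym y f m x : pending y f m x -> pending x (opposite f m) m y.
Proof.
case=> na r na' le; split=> //; last by rewrite half_len_iter half_len_back.
- exact: run_back r.
- by rewrite oppositeK.
Qed.

(** A run is determined by its starting point, so none gets past the point where
another one is stuck. *)
Lemma run_stuck k k' y f x x' : run E k y f x -> ~ active E (tag (label (iter k succ f))) x ->
  run E k' y f x' -> k' <= k.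
Proof.
move=> r na r'; rewrite leqNgt; apply/negP => lt.
have [s] := run_prefix lt r'.
move=> /run_rcons_inv[t [rt e]].
by rewrite (run_det cE rt r) in e; apply: na; exact: cell_active e.
Qed.

Lemma pending_det y f m x m' x' : pending y f m x -> pending y f m' x' ->
  m = m' /\ x = x'.
Proof.
move=> [_ r na _] [_ r' na' _].
have e : m = m' by apply/eqP; rewrite eqn_leq (run_stuck r' na' r) (run_stuck r na r').
by rewrite -e in r'; split=> //; exact: run_det r r'.
Qed.

(** Otherwise the relator is closed already, and then the path can be prolonged
beyond [y]. *)
Lemma pending_lt y f m x : pending y f m x -> m < closing_len f.
Proof.
case=> na r _ _; rewrite ltnNge; apply/negP => le.
have [s rs] := run_prefix le r.
have := closeE (f := back f) (p := y) (q := s); rewrite closing_len_back => /(_ rs)/(closed_back cE).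
rewrite backK /closed; have := small_pieces f; have := piece_gt0 f.
case: (len f) => [|k]; first by lia.
by move=> _ _ [t [e _]]; apply: na; exact: cell_active e.
Qed.

Lemma pending_live y f m x : pending y f m x -> live n y.
Proof.
case=> _ r _; have := small_pieces f; have := piece_gt0 f.
case: m r => [|m] /= => [_|[s [e _]] _ _ _]; last exact: liveE e.
by rewrite /half_len; lia.
Qed.

(** Length of the branch that grows out of [y].  The missing part is shared out
evenly between the two ends; if its length is odd, [sgn] decides which end
supplies the extra letter, so that the two ends agree about it. *)
Definition arm f m := let L := len f - m in if sgn f then L./2 else L - L./2.

Lemma arm_opposite f m : arm (opposite f m) m = len f - m - arm f m.
Proof. by rewrite /arm sgn_opposite len_opposite; case: (sgn f) => /=; lia. Qed.

Lemma arm_bounds y f m x : pending y f m x ->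
  [/\ 4 * piece f + 10 <= arm f m, arm f m + arm (opposite f m) m + m = len f
     & half_len f <= m < len f].
Proof.
move=> P; have := pending_lt P; case: P => _ _ _.
have := small_pieces f; have := piece_gt0 f.
rewrite arm_opposite /closing_len /half_len /arm; case: (sgn f) => *; split; lia.
Qed.

(** The cells added in a round.  Those with [w = [::]] are planted at a point where
a factor does not act; the others stand along the branches that complete pending
paths, after the initial part [w] of the branch. *)
Definition newCell y w i :=
  [/\ w = [::], live n y & ~ active E i y] \/
  exists f m x k, [/\ pending y f m x, 0 < k < arm f m, w = labels k f
                    & i = tag (label (iter k succ f))].

(** The tips of the two branches of a pending path are one point.  It is named after
the branch whose phase has positive sign; the tip of the other one is
redirected to this name. *)
Definition alias y w z := exists f m x,
  [/\ pending y f m x, ~~ sgn f, w = labels (arm f m) f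
    & z = (n, labels (arm (opposite f m) m) (opposite f m)) :: x].

Definition plain y w : point := if w is [::] then y else (n, w) :: y.

Definition name y w : point :=
  if pselect (exists z, alias y w z) is left e then projT1 (cid e) else plain y w.

(** A branch is longer than a piece, so its letters reveal its phase. *)
Lemma labels_arm_inj y f m x y' f' m' x' : pending y f m x -> pending y' f' m' x' ->
  y = y' -> labels (arm f m) f = labels (arm f' m') f' -> [/\ f = f', m = m' & x = x'].
Proof.
move=> P P' ey e; have [b _ _] := arm_bounds P.
have ef : f = f'.
  have eh := labels_eq_size e; rewrite -eh in e; apply: labels_piece e _; lia.
by subst y' f'; have [-> ->] := pending_det P P'.
Qed.

Lemma aliasE y w z : alias y w z -> name y w = z.
Proof.
move=> a; rewrite /name; case: pselect => [e|[]]; last by exists z.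
case: (cid e) => z' /= a'.
case: a a' => f [m [x [P s ew ->]]] [f' [m' [x' [P' s' ew' ->]]]].
rewrite ew' in ew; have [-> -> ->] := labels_arm_inj P' P erefl ew.
by [].
Qed.

Lemma plainE y w : ~ (exists z, alias y w z) -> name y w = plain y w.
Proof. by move=> na; rewrite /name; case: pselect. Qed.

Lemma name_plain_or y w : name y w = plain y w \/ alias y w (name y w).
Proof.
have [[z a]|na] := EM (exists z, alias y w z); last by left; exact: plainE.
by right; rewrite (aliasE a).
Qed.

Lemma live_neq p w : live n ((n, w) :: p) = false.
Proof. by rewrite /= ltnn. Qed.

Lemma plain_inj y y' w w' : live n y -> live n y' -> plain y w = plain y' w' ->
  y = y' /\ w = w'.
Proof.
case: w w' => [|l w] [|l' w'] //= ly ly'.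
- by move=> e; rewrite e live_neq in ly.
- by move=> e; rewrite -e live_neq in ly'.
- by case=> -> -> ->.
Qed.

Lemma plain_notlive y w : w <> [::] -> ~ live n (plain y w).
Proof. by case: w => // l w _ /=; rewrite ltnn. Qed.

Lemma newCell_live y w i : newCell y w i -> live n y.
Proof. by case=> [[]//|[f [m [x [k [P _ _ _]]]]]]; exact: pending_live P. Qed.

Lemma newCell_first y w i : newCell y w i -> first_tag_neq i w.
Proof.
case=> [[-> //]|[f [m [x [[|k] [_ // _ -> ->]]]]]].
by rewrite /= => /esym; exact: label_alt.
Qed.

(** An initial part of a branch is never a whole branch: the two phases would
share a piece, hence be equal, and the two branches would have the same length. *)
Lemma newCell_name y w i : newCell y w i -> name y w = plain y w.
Proof.
move=> C; apply: plainE => -[z [f [m [x [P s ew _]]]]].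
have [b _ _] := arm_bounds P.
case: C => [[w0 _ _]|[f' [m' [x' [k [P' lk ew' _]]]]]].
  by move/(congr1 size): ew; rewrite w0 size_labels /=; lia.
rewrite ew in ew'; have ek := labels_eq_size ew'; rewrite -ek in ew'.
have ef : f = f' by apply: labels_piece ew' _; lia.
by subst f'; have [em _] := pending_det P P'; subst m'; lia.
Qed.

Definition cell_point y w i (a : H i) : point :=
  name y (if a == 1%g then w else existT _ i a :: w).

Lemma cell_point1 y w i : cell_point y w (1%g : H i) = name y w.
Proof. by rewrite /cell_point eqxx. Qed.

Definition newEdge : cellrel H := fun i h p q =>
  exists y w a, [/\ newCell y w i, p = cell_point y w a & q = cell_point y w (h * a)%g].

Definition grow : cellrel H := fun i h p q => E i h p q \/ newEdge h p q.

(** Only the tip of a branch can have a redirected name. *)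
Lemma cell_point_cases y w i (a : H i) : newCell y w i ->
  [\/ a = 1%g /\ cell_point y w a = plain y w,
      a <> 1%g /\ cell_point y w a = plain y (existT _ i a :: w)
    | exists f m x, [/\ a <> 1%g, pending y f m x, ~~ sgn f,
        existT _ i a :: w = labels (arm f m) f &
        cell_point y w a = plain x (labels (arm (opposite f m) m) (opposite f m))]].
Proof.
move=> C; rewrite /cell_point; case: eqP => [->|na].
  by constructor 1; split=> //; exact: newCell_name C.
have [e|] := name_plain_or y (existT _ i a :: w); first by constructor 2.
move=> [f [m [x [P s ew ->]]]]; constructor 3; exists f, m, x; split=> //.
have [_ _ _] := arm_bounds P; have := arm_bounds (pending_sym P).
by case: arm => // -[]; lia.
Qed.

(** At their common tip the two branches arrive through consecutive letters of the
relator, so through different factors. *)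
Lemma opposite_first y f m x i (a : H i) w :
  pending y f m x -> existT _ i a :: w = labels (arm f m) f ->
  first_tag_neq i (labels (arm (opposite f m) m) (opposite f m)).
Proof.
move=> P; have [b e /andP[_ lm]] := arm_bounds P; have [b' _ _] := arm_bounds (pending_sym P).
rewrite piece_opposite in b'.
case ek : (arm f m) => [|k]; first by lia.
case ek' : (arm (opposite f m) m) => [|k']; first by lia.
move=> /= [ei _]; rewrite opposite_iter; last by lia.
have -> : len f - m - k' = k.+2 by lia.
rewrite iterS label_back /= -/(iter k.+1 succ f) => ei'.
by move/(congr1 (@tag _ _)): ei => /=; rewrite -ei' iterS; exact: label_alt.
Qed.

(** Gluing two tips never joins two cells of the same factor, by
[opposite_first], nor two points of one cell.  Hence the new cells of a factor
are disjoint free orbits. *)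
Lemma cell_point_inj y w i (a : H i) y' w' a' : newCell y w i -> newCell y' w' i ->
  cell_point y w a = cell_point y' w' a' -> [/\ y = y', w = w' & a = a'].
Proof.
move=> C C'.
have ly := newCell_live C; have ly' := newCell_live C'.
have fw := newCell_first C; have fw' := newCell_first C'.
have base_alias y1 w1 y2 f m : newCell y1 w1 i -> pending y1 f m y2 ->
   w1 <> labels (arm f m) f.
  move=> C1 P1 ew; have [b _ _] := arm_bounds P1.
  case: C1 => [[w0 _ _]|[f1 [m1 [x1 [k1 [Q lk ew1 _]]]]]].
    by rewrite w0 in ew; move/(congr1 size): ew; rewrite size_labels /=; lia.
  rewrite ew in ew1; have ek := labels_eq_size ew1; rewrite -ek in ew1.
  have ef : f = f1 by apply: labels_piece ew1 _; lia.
  by subst f1; have [em _] := pending_det P1 Q; subst m1; lia.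
case: (cell_point_cases a C) => [[-> ->]|[na ->]|[f [m [x [na P s ew ->]]]]];
  case: (cell_point_cases a' C') => [[-> ->]|[na' ->]|[f' [m' [x' [na' P' s' ew' ->]]]]] e.
- by have [-> ->] := plain_inj ly ly' e.
- by have [_ ew] := plain_inj ly ly' e; rewrite ew /= in fw.
- have [ey ew] := plain_inj ly (pending_live (pending_sym P')) e.
  by rewrite ey in C; case: (base_alias _ _ _ _ _ C (pending_sym P') ew).
- by have [_ ew] := plain_inj ly ly' e; rewrite -ew /= in fw'.
- by have [ey ew] := plain_inj ly ly' e; have [ea ew'] := letter_cons_inj ew.
- have [ey ew] := plain_inj ly (pending_live (pending_sym P')) e.
  by have := opposite_first P' ew'; rewrite -ew.
- have [ey e0] := plain_inj (pending_live (pending_sym P)) ly' e.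
  by rewrite -ey in C'; case: (base_alias _ _ _ _ _ C' (pending_sym P)); rewrite -e0.
- have [ey e0] := plain_inj (pending_live (pending_sym P)) ly' e.
  by have := opposite_first P ew; rewrite e0.
- have [ex ewx] := plain_inj (pending_live (pending_sym P)) (pending_live (pending_sym P')) e.
  have [es em ey] := labels_arm_inj (pending_sym P) (pending_sym P') ex ewx.
  have ef : f = f' by rewrite -(oppositeK f m) es em oppositeK.
  subst f' m'; have e1 := etrans ew (esym ew').
  by have [ea eww] := letter_cons_inj e1.
Qed.

Lemma name_nil y : name y [::] = y.
Proof.
rewrite plainE // => -[z [f [m [x [P _ e _]]]]].
have [b _ _] := arm_bounds P; move/(congr1 size): e; rewrite size_labels /=; lia.
Qed.

Lemma cell_point_inactive y w i (a : H i) : newCell y w i -> ~ active E i (cell_point y w a).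
Proof.
move=> C; case: (cell_point_cases a C) => [[-> ->]|[na ->]|[f [m [x [na P s ew ->]]]]].
- case: C => [[-> //]|[f [m [x [[|k] [P // _ -> _]]]]]] /live_active.
  exact: plain_notlive.
- by move/live_active; exact: plain_notlive.
- move/live_active; apply: plain_notlive => /(congr1 size).
  by have [b _ _] := arm_bounds (pending_sym P); rewrite size_labels /=; lia.
Qed.

Lemma newEdge_inactive i (h : H i) p q : newEdge h p q ->
  ~ active E i p /\ ~ active E i q.
Proof. by move=> [y [w [a [C -> ->]]]]; split; exact: cell_point_inactive. Qed.

Lemma grow_cells : cells grow.
Proof.
split.
- move=> i h h' p q [e|[y [w [a [C -> _]]]]].
    by have [q' e'] := cell_total cE h' e; exists q'; left.
  by exists (cell_point y w (h' * a)%g); right; exists y, w, a.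
- move=> i h h' p q s [e|e] [e'|e'].
  + by left; exact: (cell_mul cE e e').
  + by case: (newEdge_inactive e') => -[]; exact: (cell_activeR cE e).
  + by case: (newEdge_inactive e) => _ []; exact: (cell_active cE e').
  + right; case: e e' => y [w [a [C -> ->]]] [y' [w' [a' [C' e ->]]]].
    have [ey ew ea] := cell_point_inj C C' e; subst y' w' a'.
    by exists y, w, a; rewrite mulgA.
- move=> i h p q q' [e|e] [e'|e'].
  + exact: (cell_fun cE e e').
  + by case: (newEdge_inactive e') => -[]; exact: (cell_active cE e).
  + by case: (newEdge_inactive e) => -[]; exact: (cell_active cE e').
  + case: e e' => y [w [a [C -> ->]]] [y' [w' [a' [C' e ->]]]].
    by have [ey ew ea] := cell_point_inj C C' e; subst y' w' a'.
- move=> i h p q [e|[y [w [a [C -> ->]]]]]; first by left; exact: (cell_inv cE e).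
  by right; exists y, w, (h * a)%g; rewrite mulKg.
- move=> i h p [e|[y [w [a [C -> e]]]]]; first exact: (cell_free cE e).
  have [_ _ ea] := cell_point_inj C C e.
  by have := mulgK a h; rewrite -ea mulgV => <-.
Qed.

Lemma grow_sub i h p q : E i h p q -> grow h p q.
Proof. by left. Qed.

Lemma cell_point_letter y w l : tagged l <> 1%g -> cell_point y w (tagged l) = name y (l :: w).
Proof. by case: l => i h /= /eqP/negbTE e; rewrite /cell_point e. Qed.

Lemma newCell_step y w l : newCell y w (tag l) -> tagged l <> 1%g ->
  step grow l (name y w) (name y (l :: w)).
Proof.
move=> C nl; right; exists y, w, 1%g; split=> //; first by rewrite cell_point1.
by rewrite mulg1 cell_point_letter.
Qed.

Lemma pending_newCell y f m x k : pending y f m x -> k < arm f m ->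
  newCell y (labels k f) (tag (label (iter k succ f))).
Proof.
move=> P lk; case: k lk => [|k] lk; last by right; exists f, m, x, k.+1.
by left; split=> //; [exact: pending_live P | case: P].
Qed.

Lemma pending_run y f m x k : pending y f m x -> k <= arm f m ->
  run grow k y f (name y (labels k f)).
Proof.
move=> P; elim: k => [|k IH] lk; first by rewrite /= name_nil.
apply: run_rcons (IH (ltnW lk)) _.
by apply: newCell_step; [exact: pending_newCell P lk | exact: label_neq1].
Qed.

Lemma glue_name y f m x : pending y f m x ->
  name y (labels (arm f m) f) = name x (labels (arm (opposite f m) m) (opposite f m)).
Proof.
wlog s : y f m x / ~~ sgn f => [th P|P].
  have [s|/negPn s] := boolP (~~ sgn f); first exact: th.
  have := th x (opposite f m) m y; rewrite oppositeK sgn_opposite s => -> //.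
  exact: pending_sym.
have a : alias y (labels (arm f m) f) ((n, labels (arm (opposite f m) m) (opposite f m)) :: x).
  by exists f, m, x.
rewrite (aliasE a) plainE.
  have [b _ _] := arm_bounds (pending_sym P).
  by case: (arm (opposite f m) m) b => [|k] //; lia.
move=> [z [f' [m' [x' [P' s' e _]]]]].
have [es _ _] := labels_arm_inj (pending_sym P) P' erefl e.
by move: s'; rewrite -es sgn_opposite s.
Qed.

(** One branch leads up to the tip, the other one down to [x], and the old path back
to [y]. *)
Lemma pending_closed y f m x : pending y f m x -> closed grow y f.
Proof.
move=> P; have [b e lm] := arm_bounds P.
have Ps := pending_sym P.
rewrite /closed -{1}e -addnA; apply/run_add; exists (name y (labels (arm f m) f)).
split; first exact: pending_run P _.
apply/run_add; exists x; split; last first.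
  case: Ps => _ r _ _; apply: (run_sub grow_sub).
  rewrite -iterD; have -> : arm (opposite f m) m + arm f m = len f - m by lia.
  suff <- : back (opposite f m) = iter (len f - m) succ f by [].
  by rewrite /opposite -back_period ?len_back ?backK //; lia.
have := run_back grow_cells (pending_run Ps (leqnn _)).
rewrite -(glue_name P) opposite_iter; last by lia.
by rewrite backK; have -> : len f - m - arm (opposite f m) m = arm f m by lia.
Qed.

Lemma edge_in_cell y w i (a h : H i) q : newCell y w i -> grow h (cell_point y w a) q ->
  q = cell_point y w (h * a)%g.
Proof.
move=> C [/(cell_active cE)|]; first by move/(cell_point_inactive C).
by move=> [y' [w' [a' [C' e ->]]]]; have [ey ew ea] := cell_point_inj C C' e; subst.
Qed.

Lemma arm_neq_nil y f m x : pending y f m x -> labels (arm f m) f <> [::].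
Proof. by case/arm_bounds; case: arm => // ?; lia. Qed.

Lemma name_pos y f m x : pending y f m x -> sgn f ->
  name y (labels (arm f m) f) = plain y (labels (arm f m) f).
Proof.
move=> P s; apply: plainE => -[z [f' [m' [x' [P' s' e _]]]]].
by have [ef _ _] := labels_arm_inj P P' erefl e; rewrite -ef s in s'.
Qed.

(** At a new point a factor acts because the point was reached through it, because
a cell was planted there, or because the branch glued at this tip arrives
through it. *)
Lemma plain_edge y w i (h : H i) q : live n y -> w <> [::] ->
  grow h (plain y w) q ->
  [\/ exists l u, w = l :: u /\ tag l = i, newCell y w i
    | exists f m x, [/\ pending y f m x, sgn f, w = labels (arm f m) f
        & i = tag (label (iter (arm f m) succ f))]].
Proof.
move=> ly wn [/liveE /(plain_notlive wn) //|[y' [w' [a [C + _]]]]].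
case: (cell_point_cases a C) => [[_ ->]|[na ->]|[f [m [x [na P s ew ->]]]]] e.
- by have [ey ew] := plain_inj ly (newCell_live C) e; subst; constructor 2.
- have [ey ew] := plain_inj ly (newCell_live C) e; subst; constructor 1.
  by exists (existT _ i a), w'.
- have [ey ew'] := plain_inj ly (pending_live (pending_sym P)) e; subst y.
  constructor 3; exists (opposite f m), m, y'; split=> //.
  + exact: pending_sym.
  + by rewrite sgn_opposite.
  + have [b el _] := arm_bounds P; rewrite opposite_iter; last by lia.
    have -> : len f - m - arm (opposite f m) m = arm f m by lia.
    case: (arm f m) ew b => [|k] /=; first by lia.
    by move/(congr1 (head (existT _ i a))) => /= e0 _; rewrite label_back -e0.
Qed.

(** A letter that leaves a branch beyond its first piece leads to a dead end: a
branch that passes there would share a piece with this one. *)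
Lemma name_dead y f m x k l i (h : H i) q : pending y f m x ->
  piece f <= k < arm f m -> l <> label (iter k succ f) ->
  grow h (name y (l :: labels k f)) q -> i = tag l.
Proof.
move=> P /andP[pk kh] nl.
have bad k' f' m' x' : pending y f' m' x' -> l :: labels k f = labels k' f' -> False.
  case: k' => [//|k'] P' /= [el ew]; have ek := labels_eq_size ew; rewrite -ek in ew.
  by have ef := labels_piece ew pk; apply: nl; rewrite el -ef -ek.
rewrite plainE; last by move=> [z [f' [m' [x' [P' _ /(bad _ _ _ _ P')]]]]].
case/(plain_edge (pending_live P)) => // [[l' [u [[-> _] ->]]] //||].
  by case=> [[//]|[f' [m' [x' [k' [P' _ /(bad _ _ _ _ P')]]]]]].
by move=> [f' [m' [x' [P' _ /(bad _ _ _ _ P')]]]].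
Qed.

Lemma labels_rcons k f : labels k.+1 f = rcons (labels k (succ f)) (label f).
Proof. by elim: k => //= k <-; rewrite -iterS iterSr. Qed.

(** Beyond the first piece there is no way out of a branch except to dead ends, so a
run that turns towards the root has to spell the branch backwards. *)
Lemma climb y f m x s : forall k g q, pending y f m x ->
  piece f + s < k <= arm f m ->
  tag (label g) = tag (label (iter k.-1 succ f)) ->
  run grow s.+1 (name y (labels k f)) g q ->
  labels s g = labels s (back (iter k succ f)).
Proof.
elim: s => [//|s IH] [|k] // g q P /andP[lk kh] eg [p [e r]].
have C := pending_newCell P kh.
have nf : tagged (label (iter k succ f)) <> 1%g by exact: label_neq1.
have ename : name y (labels k.+1 f) = cell_point y (labels k f) (tagged (label (iter k succ f))).
  by rewrite cell_point_letter.
rewrite ename in e; rewrite !labels_rcons iterS succ_back label_back.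
have back_down : labels k f <> [::] -> p = name y (labels k f) ->
    tag (label (succ g)) = tag (label (iter k.-1 succ f)).
  move=> kn ep; case: r => p' [e' _]; move: e'; rewrite ep (newCell_name C).
  case/(plain_edge (pending_live P) kn) => [[l [u [ew <-]]]||].
  - by case: (k) ew => //= k' [->].
  - case=> [[//]|[f' [m' [x' [k' [P' _ ew et]]]]]].
    have ek := labels_eq_size ew; rewrite -ek in ew et.
    have ef : f = f' by apply: labels_piece ew _; lia.
    by case: (label_alt (f := g)); rewrite et eg ef.
  - move=> [f' [m' [x' [P' _ ew _]]]].
    have ek := labels_eq_size ew; rewrite ek in ew.
    have ef : f = f' by apply: labels_piece ew _; lia.
    by subst f'; have [em _] := pending_det P P'; subst m'; lia.
move: back_down (label_alt (f := g)) (label_neq1 (f := g)) eg e C => /=.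
rewrite /step; case: (label g) => i h /= back_down alt nh ei.
case el: (label (iter k succ f)) nf ei => [j a] /= nf ei; subst j => e C.
have ep := edge_in_cell C e.
have [ha|ha] := eqVneq (h * a)%g 1%g; last first.
  case: r => p' [e' _].
  suff /alt : tag (label (succ g)) = i by [].
  move: e'; rewrite ep /cell_point (negbTE ha) => /(name_dead P).
  apply; first by lia.
  rewrite el => e0; have e1 := letter_inj e0.
  by apply: nh; rewrite -[h](mulgK a) e1 mulgV.
have eh : h = a^-1%g by rewrite -[h](mulgK a) ha mul1g.
rewrite ha cell_point1 in ep; rewrite ep in r.
rewrite /linv /= -eh; congr rcons; apply: IH P _ _ r; first by lia.
apply: back_down ep.
by case: (k) lk => //; lia.
Qed.

Lemma labels_piece_min k f g : labels k f = labels k g -> minn (piece f) (piece g) <= k ->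
  f = g.
Proof.
by move=> e; rewrite geq_min => /orP[/(labels_piece e)|/(labels_piece (esym e))].
Qed.

Lemma glue_first y f m x i (h : H i) q : pending y f m x ->
  grow h (name y (labels (arm f m) f)) q ->
  i = tag (label (iter (arm f m).-1 succ f)) \/
  i = tag (label (iter (arm (opposite f m) m).-1 succ (opposite f m))).
Proof.
wlog s : y f m x / sgn f => [th P e|P].
  have [s|s] := boolP (sgn f); first exact: th P e.
  have s' : sgn (opposite f m) by rewrite sgn_opposite.
  have := th x (opposite f m) m y s' (pending_sym P).
  by rewrite oppositeK -(glue_name P) => /(_ e)[]; [right | left].
rewrite (name_pos P s) => /(plain_edge (pending_live P) (arm_neq_nil P)).
case=> [[l [u [ew <-]]]||[f' [m' [x' [P' s' ew ->]]]]].
- by left; case: (arm f m) ew => //= k [->].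
- case=> [[w0]|[f' [m' [x' [k' [P' lk ew _]]]]]]; first by case: (arm_neq_nil P).
  have [b _ _] := arm_bounds P.
  have ek := labels_eq_size ew; rewrite -ek in ew lk.
  have ef : f = f' by apply: labels_piece ew _; lia.
  by subst f'; have [em _] := pending_det P P'; subst m'; lia.
- have [ef em _] := labels_arm_inj P P' erefl ew; subst f' m'; right.
  have [b e lm] := arm_bounds (pending_sym P); rewrite piece_opposite len_opposite oppositeK in b e.
  rewrite opposite_iter; last by lia.
  have -> : len f - m - (arm (opposite f m) m).-1 = (arm f m).+1 by lia.
  by rewrite iterS label_back.
Qed.

(** A run that leaves a tip climbs down one of the two branches.  After a piece,
small cancellation shows that it reads the relator of the pending path. *)
Lemma glue_closed y f m x g q : pending y f m x ->
  run grow (minn (piece f) (piece g)).+1 (name y (labels (arm f m) f)) g q ->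
  closed grow (name y (labels (arm f m) f)) g.
Proof.
move=> P r; case: (r) => p [e _].
wlog eg : y f m x P r e / tag (label g) = tag (label (iter (arm f m).-1 succ f)).
  move=> th; have [eg|eg] := glue_first P e; first exact: th P r e eg.
  rewrite (glue_name P) in r e *; apply: th (pending_sym P) _ e eg.
  by rewrite piece_opposite.
have [b _ _] := arm_bounds P.
have ew := climb P (s := minn (piece f) (piece g)) (k := arm f m) _ eg r.
have {}ew : g = back (iter (arm f m) succ f).
  apply: labels_piece_min (ew _) _; last by rewrite piece_back piece_iter minnC.
  by rewrite leqnn andbT; have := geq_minl (piece f) (piece g); lia.
rewrite ew; apply: closed_back grow_cells _.
apply/(closed_run grow_cells (pending_run P (leqnn _))); exact: pending_closed P.
Qed.

(** A run that moves away from the old points piles up its letters on the name of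
its starting point, until it meets a tip. *)
Lemma descend y w g j q : live n y -> first_tag_neq (tag (label g)) w ->
  (w = [::] -> ~ active E (tag (label g)) y) -> run grow j (plain y w) g q ->
  (exists j' f m x, [/\ j' <= j, pending y f m x, labels j' g ++ w = labels (arm f m) f
     & run grow j' (plain y w) g (name y (labels (arm f m) f))]) \/
  q = plain y (labels j g ++ w) /\
  (0 < j -> newCell y (labels j.-1 g ++ w) (tag (label (iter j.-1 succ g)))).
Proof.
move=> ly fw aw; elim: j q => [|j IH] q; first by move=> <-; right.
move=> /run_rcons_inv[p [r e]].
have [[j' [f [m [x [lj P ew rg]]]]]|[ep Cp]] := IH _ r.
  by left; exists j', f, m, x; split=> //; exact: leq_trans lj _.
set w' := labels j g ++ w in ep.
have fw' : first_tag_neq (tag (label (iter j succ g))) w'.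
  by rewrite /w'; case: (j) => [|k] //= /esym; exact: label_alt.
have base : newCell y w' (tag (label (iter j succ g))) ->
    q = name y (label (iter j succ g) :: w').
  move=> C; rewrite /step ep -(newCell_name C) -(cell_point1 _ _ (tag (label (iter j succ g)))) in e.
  by rewrite (edge_in_cell C e) mulg1 cell_point_letter //; exact: label_neq1.
have fin : newCell y w' (tag (label (iter j succ g))) ->
   (exists j' f m x, [/\ j' <= j.+1, pending y f m x, labels j' g ++ w = labels (arm f m) f
     & run grow j' (plain y w) g (name y (labels (arm f m) f))]) \/
   q = plain y (labels j.+1 g ++ w) /\
     (0 < j.+1 -> newCell y (labels j.+1.-1 g ++ w) (tag (label (iter j.+1.-1 succ g)))).
  move=> C; have eq := base C.
  have [en|] := name_plain_or y (label (iter j succ g) :: w').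
    by right; split=> //; rewrite eq en.
  move=> [f [m [x [P s ew _]]]]; left; exists j.+1, f, m, x; split=> //.
  by rewrite -ew -eq; exact: run_rcons r e.
have [w0|wn] := EM (w' = [::]).
  have j0 : j = 0 by move/(congr1 size): w0; rewrite /w' size_cat size_labels /=; lia.
  apply: fin; subst j; rewrite /w' /= in w0 ep e *; rewrite w0 in ep aw *.
  case: e => [/(cell_active cE)|]; first by rewrite ep => /(aw erefl).
  move=> [y' [v [a [C + _]]]]; rewrite ep /=.
  case: (cell_point_cases a C) => [[_ ->]|[na ->]|[f [m [x [na P s ew ->]]]]] ey.
  - have [e1 e2] := @plain_inj y y' [::] v ly (newCell_live C) ey.
    by subst y' v.
  - by have [] := @plain_inj y y' [::] _ ly (newCell_live C) ey.
  - have [_ e2] := @plain_inj y x [::] _ ly (pending_live (pending_sym P)) ey.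
    by case: (arm_neq_nil (pending_sym P)).
rewrite /step ep in e; case: (plain_edge ly wn e) => [[l [u [ew el]]]|//|].
  by rewrite ew /= in fw'.
move=> [f [m [x [P s ew _]]]]; left; exists j, f, m, x; split=> //.
by rewrite (name_pos P s) -ew -ep.
Qed.

(** If the run meets a tip within a piece, it goes on for another piece from there and
[glue_closed] applies.  Otherwise it ends in a cell on a branch whose last letters
are a piece of the run, so that the run belongs to the relator of this branch. *)
Lemma descend_closed y w g q : live n y -> first_tag_neq (tag (label g)) w ->
  (w = [::] -> ~ active E (tag (label g)) y) ->
  run grow (2 * piece g + 5) (plain y w) g q -> closed grow (plain y w) g.
Proof.
move=> ly fw aw r.
have [p r1] : exists p, run grow (piece g).+1 (plain y w) g p.
  by apply: run_prefix r; lia.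
have p0 := piece_gt0 g.
case: (descend ly fw aw r1) => [[j [f [m [x [lj P ew rg]]]]]|[_ /(_ isT)]] /=.
  apply/(closed_run grow_cells rg).
  have [q' r2] : exists q, run grow (j + (piece g).+1) (plain y w) g q.
    by apply: run_prefix r; lia.
  case/run_add: r2 => p' [rp' r2].
  rewrite (run_det grow_cells rp' rg) in r2.
  have le : (minn (piece f) (piece (iter j succ g))).+1 <= (piece g).+1.
    by rewrite piece_iter ltnS geq_minr.
  by have [q2 r3] := run_prefix le r2; exact: glue_closed P r3.
case=> [[/(congr1 size)]|[f [m [x [k [P /andP[_ lk] ew _]]]]]].
  by rewrite size_cat size_labels /=; lia.
have ek : k = piece g + size w by rewrite -(size_labels k f) -ew size_cat size_labels.
rewrite ek in ew lk.
have [ew1 ew2] := labels_split erefl (esym ew).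
have eg : g = iter (size w) succ f by apply: labels_piece (esym ew2) _.
have lw : size w < arm f m by lia.
have -> : plain y w = name y (labels (size w) f).
  by rewrite (newCell_name (pending_newCell P lw)) ew1.
rewrite eg; apply/(closed_run grow_cells (pending_run P (ltnW lw))).
exact: pending_closed P.
Qed.

Lemma newEdge_point i (h : H i) p q : newEdge h p q -> exists y w, live n y /\ p = plain y w.
Proof.
move=> [y [w [a [C -> _]]]]; have ly := newCell_live C.
case: (cell_point_cases a C) => [[_ ->]|[_ ->]|[f [m [x [_ P _ _ ->]]]]].
- by exists y, w.
- by exists y, (existT _ i a :: w).
- by exists x, (labels (arm (opposite f m) m) (opposite f m)); split=> //; exact: pending_live (pending_sym P).
Qed.

Lemma run_grow_or k p f q : run grow k p f q -> run newEdge k p f q \/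
  exists j s s', [/\ j < k, run newEdge j p f s, step E (label (iter j succ f)) s s'
    & run grow (k - j.+1) s' (iter j.+1 succ f) q].
Proof.
elim: k p f => [|k IH] p f /=; first by left.
move=> [s [[e|e] r]]; first by right; exists 0, p, s; rewrite subn1.
case: (IH _ _ r) => [r'|[j [t [t' [lj r1 e' r2]]]]]; first by left; exists s.
right; exists j.+1, t, t'; split=> //.
- by exists s.
- by rewrite iterSr.
- by rewrite subSS iterSr.
Qed.

(** Look at the middle of the run.  It leaves in two directions, through different
factors, and at most one of them leads towards the old points; in the other
direction [descend_closed] applies. *)
Lemma new_run_closed k p f q : run newEdge k p f q -> 4 * piece f + 10 <= k ->
  closed grow p f.
Proof.
have sub i (h : H i) p0 q0 : newEdge h p0 q0 -> grow h p0 q0 by right.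
set M := 2 * piece f + 5 => r le.
have [q' {}r] : exists q, run newEdge (M + M) p f q by apply: run_prefix r; lia.
case/run_add: r => z [r1 r2].
apply/(closed_run grow_cells (run_sub sub r1)).
have r3 := run_back grow_cells (run_sub sub r1).
have tneq : tag (label (iter M succ f)) <> tag (label (back (iter M succ f))).
  rewrite /M addnS iterS label_back; exact: label_alt.
have eM : M = M.-1.+1 by rewrite /M addnS.
have e1 : exists s, newEdge (tagged (label (iter M succ f))) z s.
  by move: r2; rewrite {1}eM => -[s [e _]]; exists s.
have e2 : exists s, newEdge (tagged (label (back (iter M succ f)))) z s.
  rewrite eM in r1; have [s [_ e]] := run_rcons_inv r1.
  exists s; rewrite eM iterS label_back.
  case: e => y [w [a [C -> ->]]].
  by exists y, w, (tagged (label (iter M.-1 succ f)) * a)%g; rewrite mulKg.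
have [y [w [ly ez]]] := newEdge_point (proj2_sig (cid e1)).
have inact g : (exists s, newEdge (tagged (label g)) z s) -> w = [::] ->
    ~ active E (tag (label g)) y.
  by move=> [s e] w0; move: ez (newEdge_inactive e) => ->; rewrite w0 => -[].
have [fw|fw] := EM (first_tag_neq (tag (label (iter M succ f))) w).
  rewrite ez; apply: (descend_closed (q := q')) => //; first exact: inact e1.
  by rewrite piece_iter -ez; exact: run_sub sub r2.
(* The forward direction leaves through the factor by which [w] arrived, so the
   other one does not. *)
have {fw}fw' : first_tag_neq (tag (label (back (iter M succ f)))) w.
  by case: (w) fw => //= l _ fw e; apply: fw; rewrite e; exact: not_eq_sym.
rewrite -[iter M succ f]backK; apply: closed_back grow_cells _.
rewrite ez; apply: (descend_closed (q := p)) => //; first by exact: inact e2.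
by rewrite piece_back piece_iter -ez.
Qed.

Lemma max_run g p : (exists q, run E (closing_len g) p g q) \/
  exists a q, [/\ a < closing_len g, run E a p g q & ~ active E (tag (label (iter a succ g))) q].
Proof.
elim: (closing_len g) => [|k [[q r]|[a [q [la r na]]]]]; first by left; exists p.
  have [ac|na] := EM (active E (tag (label (iter k succ g))) q); last first.
    by right; exists k, q.
  left; have [q1 e] := active_cell cE (tagged (label (iter k succ g))) ac.
  by exists q1; exact: run_rcons r e.
by right; exists a, q; split=> //; exact: ltnW.
Qed.

Lemma closed_grow p f : closed E p f -> closed grow p f.
Proof. exact: (run_sub grow_sub). Qed.

(** Prolong the run in both directions as far as possible.  The result is either long
enough to be closed already, or a pending path that the round completes. *)
Lemma old_run_closed p f q : run E (half_len f) p f q -> closed grow p f.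
Proof.
move=> r; have [[q0 /closeE]|[a [y [la ra na]]]] := max_run f p; first exact: closed_grow.
have lea : half_len f <= a by exact: run_stuck ra na r.
apply/(closed_run grow_cells (run_sub grow_sub ra)).
have [[q0 /closeE]|[b [x [lb rb nb]]]] := max_run (back (iter a succ f)) y.
  by move/(closed_back cE); rewrite backK; exact: closed_grow.
apply: (@pending_closed _ _ b x); split=> //.
by rewrite half_len_iter; apply: leq_trans lea _; apply: run_stuck rb nb (run_back cE ra).
Qed.

Lemma leave_closed g y q : live n y -> ~ active E (tag (label g)) y ->
  run grow (2 * piece g + 5) y g q -> closed grow y g.
Proof. by move=> ly na r; apply: (@descend_closed y [::] g q). Qed.

(** The invariant passes to the next round.  A run that uses no old edge is treated by
[new_run_closed].  Otherwise it is cut where it enters and where it leaves the old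
points: either a part outside them is long enough for [descend_closed], or the
part between is at least half of the relator and [old_run_closed] applies. *)
Lemma grow_close f p q : run grow (closing_len f) p f q -> closed grow p f.
Proof.
move=> r.
have sub i (h : H i) p0 q0 : newEdge h p0 q0 -> grow h p0 q0 by right.
case: (run_grow_or r) => [rn|[j [s [s' [lj rn e r']]]]].
  by apply: new_run_closed rn _; rewrite /closing_len; lia.
have rg := run_sub sub rn.
(* A long part before the first old point descends when it is read backwards. *)
have [lej|ltj] := leqP (2 * piece f + 5) j.
  apply/(closed_run grow_cells rg).
  rewrite -[iter j succ f]backK; apply: closed_back grow_cells _.
  have [q0 r0] : exists q0, run grow (2 * piece (back (iter j succ f)) + 5) s (back (iter j succ f)) q0.
    by apply: run_prefix (run_back grow_cells rg); rewrite piece_back piece_iter.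
  apply: leave_closed (liveE e) _ r0.
  case: j rn {lj e r' rg} lej => [|j] rn lej; first by lia.
  have [t [_ e]] := run_rcons_inv rn.
  by rewrite iterS label_back; case: (newEdge_inactive e).
apply/(closed_run grow_cells rg).
have ls := liveE e.
have {e r'}r1 : run grow (closing_len f - j) s (iter j succ f) q.
  have -> : closing_len f - j = (closing_len f - j.+1).+1 by lia.
  by exists s'; split=> //; left.
set g := iter j succ f in r1 *.
have {rg rn lj ltj r} lem : half_len g + (2 * piece g + 5) <= closing_len f - j.
  by rewrite /g half_len_iter piece_iter; rewrite /closing_len in lj *; lia.
have [[q0 /closeE]|[a [y [la ra na]]]] := max_run g s; first exact: closed_grow.
(* Among the old points the run gets [a] letters far; if this is less than half of
   the relator, a long part is left after it. *)
have [lea|lta] := leqP (half_len g) a.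
  by have [q1 r2] := run_prefix lea ra; exact: old_run_closed r2.
apply/(closed_run grow_cells (run_sub grow_sub ra)).
have [q2 r2] : exists q2, run grow (a + (2 * piece g + 5)) s g q2.
  by apply: run_prefix r1; lia.
case/run_add: r2 => t [rt r2].
rewrite (run_det grow_cells rt (run_sub grow_sub ra)) in r2.
apply: (leave_closed (q := q2)) => //; last by rewrite piece_iter.
case: a ra {la na lta rt r2} => [<- //|a ra].
by have [u [_ e]] := run_rcons_inv ra; exact: liveER e.
Qed.

Lemma live_le m k p : m <= k -> live m p -> live k p.
Proof. by move=> le; apply: sub_all => a; move/leq_trans; apply. Qed.

Lemma grow_live i (h : H i) p q : grow h p q -> live n.+1 p.
Proof.
case=> [/liveE|/newEdge_point[y [w [ly ->]]]]; first exact: live_le.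
have ly' := live_le (leqnSn n) ly.
by case: w => [//|l w] /=; rewrite ltnSn ly'.
Qed.

Lemma grow_active i p : live n p -> active grow i p.
Proof.
move=> lp; have [a|na] := EM (active E i p); first by left.
right; exists p, [::], 1%g; rewrite mulg1 cell_point1 name_nil; split=> //.
by left.
Qed.

End Round.

Section Limit.
Context (I : Type) (H : I -> groupType) (R : relatorSystem H).
Implicit Types (f : R) (p q : point H).

Fixpoint layer n : cellrel H :=
  if n is k.+1 then grow R (layer k) k else fun _ _ _ _ => False.
Arguments layer n i : clear implicits.

Lemma layerP n : [/\ cells (layer n), forall i h p q, layer n i h p q -> live n p
  & forall f p q, run (layer n) (closing_len f) p f q -> closed (layer n) p f].
Proof.
elim: n => [|n [cE lE xE]].
  split=> [|//|f p q]; first by split.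
  have : 0 < closing_len f by rewrite /closing_len; lia.
  by case: (closing_len f) => // k _ [s []].
split; [exact: grow_cells | exact: grow_live | exact: grow_close].
Qed.

Lemma layer_le m n i h p q : m <= n -> layer m i h p q -> layer n i h p q.
Proof.
move=> /subnK<-; elim: (n - m) => // k IH e; rewrite addSn; left; exact: IH.
Qed.

Definition limit i h p q := exists n, layer n i h p q.

(** A point is live from some round on, and the next round lets every factor act
at it. *)
Lemma limit_total i (h : H i) p : exists q, limit h p q.
Proof.
have [n lp] : exists n, live n p.
  elim: p => [|[k w] p [n lp]]; first by exists 0.
  exists (maxn n k.+1); apply/andP; split; first by rewrite /= leq_maxr.
  exact: live_le (leq_maxl _ _) lp.
have [cE lE xE] := layerP n; have [cE' _ _] := layerP n.+1.
have [q e] := active_cell cE' h (grow_active cE xE i lp).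
by exists q, n.+1.
Qed.

Lemma limit_fun i (h : H i) p q q' : limit h p q -> limit h p q' -> q = q'.
Proof.
move=> [m e] [n e']; have [c _ _] := layerP (maxn m n).
apply: (cell_fun c (layer_le (leq_maxl m n) e) (layer_le (leq_maxr m n) e')).
Qed.

Definition act i (h : H i) p : point H := projT1 (cid (limit_total h p)).

Lemma actP i (h : H i) p : limit h p (act h p).
Proof. exact: projT2 (cid (limit_total h p)). Qed.

Lemma actE i (h : H i) p q : limit h p q -> act h p = q.
Proof. exact: limit_fun (actP h p). Qed.

Lemma actM i (h h' : H i) p : act (h * h')%g p = act h (act h' p).
Proof.
apply: actE; have [m e] := actP h' p; have [n e'] := actP h (act h' p).
exists (maxn m n); have [c _ _] := layerP (maxn m n).
exact: (cell_mul c (layer_le (leq_maxl m n) e) (layer_le (leq_maxr m n) e')).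
Qed.

Lemma act_free i (h : H i) p : act h p = p -> h = 1%g.
Proof.
by move=> e; have [n] := actP h p; have [c _ _] := layerP n; rewrite e => /(cell_free c).
Qed.

Lemma act1 i p : act (1%g : H i) p = p.
Proof.
have [n e] := actP (1%g : H i) p; have [c _ _] := layerP n.
by apply: actE; exists n; exact: cell_active e.
Qed.

Fixpoint trace k f p : point H :=
  if k is k'.+1 then trace k' (succ f) (act (tagged (label f)) p) else p.

Lemma trace_run k f p : exists n, run (layer n) k p f (trace k f p).
Proof.
elim: k f p => [|k IH] f p /=; first by exists 0.
have [m e] := actP (tagged (label f)) p.
have [n r] := IH (succ f) (act (tagged (label f)) p).
exists (maxn m n), (act (tagged (label f)) p).
split; first exact: layer_le (leq_maxl _ _) e.
by apply: run_sub r => *; exact: layer_le (leq_maxr _ _) _.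
Qed.

(** A path of finite length lies in a single layer, where the invariant closes it. *)
Theorem trace_relator f p : trace (len f) f p = p.
Proof.
have [n r] := trace_run (len f) f p; have [c _ x] := layerP n.
apply: (run_det c r).
have lmu : closing_len f <= len f.
  by have := small_pieces f; have := piece_gt0 f; rewrite /closing_len /half_len; lia.
by have [q rq] := run_prefix lmu r; exact: x rq.
Qed.

End Limit.

(** * Marks whose distances identify a relator *)

Section Code.
Context (Q : nat) (Q_big : 2000 <= Q).

Definition spread n := 2 * Q * n.+1.
(** Consecutive marks have distance [spread n + 2 * s + 1]; as [spread n] is a
multiple of [2 * Q], this distance determines [n] and [s] when [s < Q]. *)
Definition mark n s := spread n * s + s * s.

Lemma markS n s : mark n s.+1 = mark n s + (spread n + 2 * s + 1).
Proof. by rewrite /mark; lia. Qed.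

Lemma spread_ge n : 2 * Q <= spread n.
Proof. by rewrite /spread mulnS leq_addr. Qed.

Lemma mark_lt n s t : s < t -> mark n s + (spread n + 2 * s + 1) <= mark n t.
Proof.
elim: t => // t IH; rewrite ltnS leq_eqVlt => /orP[/eqP->|/IH]; first by rewrite markS.
by rewrite (markS n t); lia.
Qed.

Lemma mark_mono n s t : (mark n s < mark n t) = (s < t).
Proof.
case: (ltngtP s t) => [/(mark_lt n)|/(mark_lt n)|->]; lia.
Qed.

Lemma mark_le n s t : (mark n s <= mark n t) = (s <= t).
Proof. by rewrite leqNgt mark_mono -leqNgt. Qed.

Lemma gap_inj n n' s s' : s < Q -> s' < Q ->
  spread n + 2 * s = spread n' + 2 * s' -> n = n' /\ s = s'.
Proof.
move=> lt lt' e.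
have {}e : n.+1 * Q + s = n'.+1 * Q + s' by rewrite /spread in e; lia.
have en : n = n'.
  have := congr1 (divn^~ Q) e; rewrite /= !divnMDl ?divn_small; lia.
by split=> //; rewrite en in e; lia.
Qed.

(** The position of the first letter of the marked block number [s]: a block has four
letters, and one letter precedes the blocks. *)
Definition center n s := 4 * mark n s + 1.

(** Consecutive centers are at most [4 * (spread n + 2 * Q)] apart, so a window four
times as long contains three of them and still leaves a margin on both sides. *)
Lemma three_centers n o w : 0 < o -> o + w <= 4 * mark n Q + 1 ->
  16 * (spread n + 2 * Q) + 16 <= w ->
  exists s, [/\ s.+2 < Q, o + 5 <= center n s & center n s.+2 + 8 <= o + w].
Proof.
move=> o0 ow lw.
have [s ls mins] : exists2 s, o + 5 <= center n s & forall t, o + 5 <= center n t -> s <= t.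
  have ex : exists s, o + 5 <= center n s by exists Q; rewrite /center; lia.
  by case: (ex_minnP ex) => s; exists s.
have [e|s0] := posnP s.
  by move: ls; rewrite e /center /mark muln0 mul0n; lia.
have lc : center n s.-1 < o + 5 by rewrite ltnNge; apply/negP => /mins; lia.
have e0 := markS n s.-1; rewrite prednK // in e0.
have e1 := markS n s; have e2 := markS n s.+1.
have sQ : s.-1 < Q by rewrite -(mark_mono n); move: lc; rewrite /center; lia.
have lc2 : center n s.+2 + 8 <= o + w by rewrite /center in lc *; lia.
exists s; split=> //.
by rewrite -(mark_mono n); move: lc2; rewrite /center; lia.
Qed.

(** A window in which the centers of two relators look the same shows the distance
of two consecutive centers, and this distance belongs to only one pair of marks. *)
Lemma decode_translation n n' o o' w : 0 < o -> o + w <= 4 * mark n Q + 1 ->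
  16 * (spread n + 2 * Q) + 16 <= w ->
  (forall j, 2 <= j -> j + 4 < w ->
     (exists2 s, s < Q & o + j + 3 = center n s) <->
     (exists2 s, s < Q & o' + j + 3 = center n' s)) ->
  n = n' /\ o = o'.
Proof.
move=> o0 ow lw same; have [s [sQ ls lw2]] := three_centers o0 ow lw.
have e1 := markS n s; have e2 := markS n s.+1.
have [t tQ et] : exists2 t, t < Q & o' + (center n s - 3 - o) + 3 = center n' t.
  apply/same; [by lia| by rewrite /center in lw2 *; lia|].
  by exists s; lia.
have [u uQ eu] : exists2 u, u < Q & o' + (center n s.+1 - 3 - o) + 3 = center n' u.
  apply/same; [by rewrite /center in ls *; lia| by rewrite /center in lw2 *; lia|].
  by exists s.+1; [lia | rewrite /center in ls *; lia].
have tu : t < u by rewrite -(mark_mono n'); rewrite /center in ls et eu *; lia.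
have eut : u = t.+1.
  apply/eqP; rewrite eqn_leq tu andbT leqNgt; apply/negP => tu'.
  have l1 := mark_lt n' tu'; have e3 := markS n' t.
  have [v vQ ev] : exists2 v, v < Q & o + (center n' t.+1 - 3 - o') + 3 = center n v.
    apply/same; rewrite /center in lw2 ls et eu *; [lia|lia|].
    by exists t.+1; lia.
  have : s < v /\ v < s.+1 by split; rewrite -(mark_mono n); rewrite /center in ls et eu ev *; lia.
  lia.
have e3 := markS n' t; rewrite eut in eu.
have [en es] : n = n' /\ s = t.
  by apply: gap_inj => //; rewrite /center in ls et eu *; lia.
by split=> //; subst n' t; rewrite /center in ls et *; lia.
Qed.

(** The distances between consecutive centers increase along a relator, so three
centers never look like three centers read in the opposite direction. *)
Lemma decode_reflection n n' o c w : 0 < o -> o + w <= 4 * mark n Q + 1 ->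
  16 * (spread n + 2 * Q) + 16 <= w ->
  (forall j, 2 <= j -> j + 4 < w ->
     (exists2 s, s < Q & o + j + 3 = center n s) <->
     (exists2 s, s < Q & center n' s + j = c)) ->
  False.
Proof.
move=> o0 ow lw same; have [s [sQ ls lw2]] := three_centers o0 ow lw.
have e1 := markS n s; have e2 := markS n s.+1.
have img v : s <= v <= s.+2 -> v < Q ->
    exists2 t, t < Q & center n' t + (center n v - 3 - o) = c.
  move=> sv vQ; have lv : mark n s <= mark n v <= mark n s.+2.
    by rewrite !mark_le.
  apply/same; rewrite /center in ls lw2 *; [lia|lia|].
  by exists v => //; lia.
have next_center v t t' : s <= v <= s.+1 -> t < Q -> center n' t + (center n v - 3 - o) = c ->
    t' < Q -> center n' t' + (center n v.+1 - 3 - o) = c -> t = t'.+1.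
  move=> sv tQ et tQ' et'; have e := markS n v.
  have lv : mark n s <= mark n v.
    by rewrite mark_le; lia.
  have lv' : mark n v.+1 <= mark n s.+2.
    by rewrite mark_le; lia.
  have tt : t' < t by rewrite -(mark_mono n'); rewrite /center in ls et et' *; lia.
  apply/eqP; rewrite eqn_leq tt andbT leqNgt; apply/negP => tt2.
  have l1 := mark_lt n' tt2; have e3 := markS n' t'.
  have [u uQ eu] : exists2 u, u < Q & o + (c - center n' t'.+1) + 3 = center n u.
    apply/same; rewrite /center in lw2 ls et et' *; [lia|lia|].
    by exists t'.+1; lia.
  have : v < u /\ u < v.+1 by split; rewrite -(mark_mono n); rewrite /center in ls et et' eu *; lia.
  lia.
have [a aQ ea] := img s ltac:(lia) ltac:(lia).
have [b bQ eb] := img s.+1 ltac:(lia) ltac:(lia).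
have [d dQ ed] := img s.+2 ltac:(lia) sQ.
have eab := next_center s a b ltac:(lia) aQ ea bQ eb.
have ebd := next_center s.+1 b d ltac:(lia) bQ eb dQ ed.
have f1 := markS n' d; have f2 := markS n' d.+1.
by subst a b; rewrite /center in ls ea eb ed; lia.
Qed.

End Code.

(** * The relators and their small cancellation condition *)

Section Relators.
Context (I : Type) (H : I -> groupType) (enc : letter H -> nat).
Context (enc_inj : injective enc) (Q : nat) (Q_big : 2000 <= Q).
Local Notation letter := (letter H).
Local Notation mark := (mark Q).
Local Notation center := (center Q).
Local Notation spread := (spread Q).

(** The four letters from which a relator is made: the relation expresses [g]
through [x], [y] and [z]. *)
Definition valid_key (x y z g : letter) :=
  [/\ [/\ tagged x <> 1%g, tagged y <> 1%g, tagged z <> 1%g & tagged g <> 1%g],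
      tag z = tag y, [/\ tag x <> tag y, tag g <> tag x & tag g <> tag y] & y <> z].

Record key := Key { kx : letter; ky : letter; kz : letter; kg : letter;
                    keyP : valid_key kx ky kz kg }.

Definition code (k : key) := pickle (enc (kx k), enc (ky k), enc (kz k), enc (kg k)).

Lemma code_inj : injective code.
Proof.
move=> [x y z g v] [x' y' z' g' v'] /(pcan_inj pickleK) /= [].
move=> /enc_inj ex /enc_inj ey /enc_inj ez /enc_inj eg; subst.
by rewrite (Prop_irrelevance v v').
Qed.

Definition marked n q := has (fun s => q == mark n s) (iota 0 Q).

Lemma markedP n q : reflect (exists2 s, s < Q & q = mark n s) (marked n q).
Proof.
apply: (iffP hasP) => [[s]|[s sQ ->]].
  by rewrite mem_iota => sQ /eqP->; exists s.
by exists s => //; rewrite mem_iota.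
Qed.

Definition block_letter k q := if marked (code k) q then ky k else kz k.

(** The letter at position 0 is the inverse of [g]; each block then takes four
positions. *)
Definition relator_letter k p : letter :=
  if p is p'.+1 then
    if odd p' then
      if p' %% 4 == 1 then block_letter k (p' %/ 4) else linv (block_letter k (p' %/ 4))
    else kx k
  else linv (kg k).

Definition relator_length k := 4 * mark (code k) Q + 1.

Lemma relator_tag0 k : tag (relator_letter k 0) = tag (kg k).
Proof. by []. Qed.

Lemma block_letter_tag k q : tag (block_letter k q) = tag (ky k).
Proof. by rewrite /block_letter; case: ifP => // _; have [_ ->] := keyP k. Qed.

Lemma relator_tag k p : 0 < p -> tag (relator_letter k p) = tag (if odd p then kx k else ky k).
Proof.
case: p => //= p _; case: (odd p) => //=.
by case: ifP => _ /=; rewrite block_letter_tag.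
Qed.

Lemma relator_tag_alt k p : 0 < p -> tag (relator_letter k p) <> tag (relator_letter k p.+1).
Proof.
move=> p0; rewrite !relator_tag //=; have [_ _ [n1 _ _] _] := keyP k.
by case: odd => //= /esym.
Qed.

Lemma relator_tag_g k p : 0 < p -> tag (relator_letter k p) <> tag (kg k).
Proof.
move=> p0; rewrite relator_tag //; have [_ _ [_ n1 n2] _] := keyP k.
by case: odd => /esym.
Qed.

Lemma relator_neq1 k p : tagged (relator_letter k p) <> 1%g.
Proof.
have [[x1 y1 z1 g1] _ _ _] := keyP k.
have b1 q : tagged (block_letter k q) <> 1%g by rewrite /block_letter; case: ifP.
have inv1 (l : letter) : tagged l <> 1%g -> tagged (linv l) <> 1%g.
  by move=> n /= e; apply: n; rewrite -[tagged l]invgK e invg1.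
case: p => [|p] /=; first exact: inv1.
by case: odd => //; case: ifP => _ //; exact: inv1.
Qed.

Lemma linv_inj : injective (@linv _ H).
Proof. exact: can_inj (@linvK _ H). Qed.

Lemma marked_change n q : marked n q <> marked n q.+1 <->
  exists2 s, s < Q & q = mark n s \/ q.+1 = mark n s.
Proof.
case: (markedP n q) => [[s sQ es]|nq]; case: (markedP n q.+1) => [[t tQ et]|nq'].
- have st : s < t by rewrite -(mark_mono Q_big n); lia.
  by have := mark_lt Q_big n st; have := spread_ge Q n; lia.
- by split=> // _; exists s; [|left].
- by split=> // _; exists t; [|right].
- split=> // -[s sQ [e|e]]; first by case: nq; exists s.
  by case: nq'; exists s.
Qed.

Lemma block_letter_change k q :
  block_letter k q <> block_letter k q.+1 <-> marked (code k) q <> marked (code k) q.+1.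
Proof.
have [_ _ _ yz] := keyP k; rewrite /block_letter.
by case: (marked _ q); case: (marked _ q.+1); split=> // _ // /esym.
Qed.

(** Positions [p] and [p + 4] belong to the same place in two consecutive blocks, so
they differ only if one of these blocks is marked and the other is not.  Marks are
isolated, so each of them causes four changes: two when the window of comparison
enters the marked block, two when it leaves it. *)
Lemma relator_change k p : 0 < p -> relator_letter k p <> relator_letter k (p + 4) <->
  exists2 s, s < Q & let m := center (code k) s in
    [\/ p + 3 = m, p + 1 = m, p = m + 1 | p = m + 3].
Proof.
case: p => // p _; rewrite addSn /= oddD addbF.
have [op|ep] := boolP (odd p); last first.
  by split=> // -[s _ /= []]; rewrite /center; lia.
have -> : (p + 4) %% 4 = p %% 4 by rewrite modnDr.
have -> : (p + 4) %/ 4 = (p %/ 4).+1 by rewrite divnDr // divnn addn1.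
set q := p %/ 4.
have -> : (if p %% 4 == 1 then block_letter k q else linv (block_letter k q)) <>
     (if p %% 4 == 1 then block_letter k q.+1 else linv (block_letter k q.+1)) <->
     block_letter k q <> block_letter k q.+1.
  by case: ifP => // _; split=> n e; apply: n; [rewrite e | exact: linv_inj].
rewrite block_letter_change marked_change.
have ep : p = 4 * q + 1 \/ p = 4 * q + 3.
  have := divn_eq p 4; rewrite -/q; have : p %% 4 < 4 by rewrite ltn_mod.
  move: op; case: (p %% 4) => [|[|[|[|]]]] // op _ e; rewrite e in op *.
  - by rewrite oddD oddM /= andbF in op.
  - by left; lia.
  - by rewrite oddD oddM /= andbF in op.
  - by right; lia.
split=> -[s sQ e]; exists s => //; rewrite /center /= in e *.
  by case: ep e => -> [->|<-]; [constructor 3|constructor 1|constructor 4|constructor 2]; lia.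
by case: ep e => -> []; lia.
Qed.

Lemma center_far n s t d : 0 < d < 20 -> center n s <> center n t + d.
Proof.
move=> dd e; have st : t < s by rewrite -(mark_mono Q_big n); move: e; rewrite /center; lia.
by have := mark_lt Q_big n st; have := spread_ge Q n; rewrite /center in e; lia.
Qed.

(** Of the four changes that a mark causes, the first one is told by the absence of
a change two letters earlier. *)
Lemma before_center k p : 2 < p ->
  relator_letter k p <> relator_letter k (p + 4) /\ relator_letter k (p - 2) = relator_letter k (p + 2) <->
  exists2 s, s < Q & p + 3 = center (code k) s.
Proof.
move=> p2; have e2 : p + 2 = p - 2 + 4 by lia.
have c1 := relator_change k (p := p) ltac:(lia).
have c2 := relator_change k (p := p - 2) ltac:(lia).
rewrite e2; split.
  move=> [/c1[s sQ /= e] neq]; exists s => //.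
  have {c2 neq} nc : ~ (exists2 s, s < Q & let m := center (code k) s in
    [\/ p - 2 + 3 = m, p - 2 + 1 = m, p - 2 = m + 1 | p - 2 = m + 3]).
    by move/c2; rewrite neq.
  case: e => [//|e|e|e]; case: nc; exists s => //=;
   [constructor 1|constructor 2|constructor 3]; lia.
move=> [s sQ e]; split; first by apply/c1; exists s => //; constructor 1.
apply: contrapT => /c2[t tQ /=].
by case=> e'; [apply: (@center_far (code k) s t 2)|apply: (@center_far (code k) s t 4)
  |apply: (@center_far (code k) s t 6)|apply: (@center_far (code k) s t 8)]; lia.
Qed.

(** The mirror image of [before_center], for relators read backwards. *)
Lemma after_center k p : 0 < p ->
  relator_letter k p <> relator_letter k (p + 4) /\ relator_letter k (p + 2) = relator_letter k (p + 6) <->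
  exists2 s, s < Q & p = center (code k) s + 3.
Proof.
move=> p0; have e2 : p + 6 = p + 2 + 4 by lia.
have c1 := relator_change k (p := p) ltac:(lia).
have c2 := relator_change k (p := p + 2) ltac:(lia).
rewrite e2; split.
  move=> [/c1[s sQ /= e] neq]; exists s => //.
  have {c2 neq} nc : ~ (exists2 s, s < Q & let m := center (code k) s in
    [\/ p + 2 + 3 = m, p + 2 + 1 = m, p + 2 = m + 1 | p + 2 = m + 3]).
    by move/c2; rewrite neq.
  case: e => [e|e|e|//]; case: nc; exists s => //=;
   [constructor 2|constructor 3|constructor 4]; lia.
move=> [s sQ e]; split; first by apply/c1; exists s => //; constructor 4.
apply: contrapT => /c2[t tQ /=].
by case=> e'; [apply: (@center_far (code k) t s 8)|apply: (@center_far (code k) t s 6)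
  |apply: (@center_far (code k) t s 4)|apply: (@center_far (code k) t s 2)]; lia.
Qed.

Record relator_phase := Phase { phase_key : key; forward : bool; position : nat; position_lt : position < relator_length phase_key }.
Implicit Types (f g : relator_phase).

Lemma phase_eq f g : phase_key f = phase_key g -> forward f = forward g -> position f = position g -> f = g.
Proof.
case: f g => [k s o l] [k' s' o' l'] /= ek es eo; subst.
by rewrite (bool_irrelevance l l').
Qed.

Definition shift_pos L (s : bool) o :=
  if s then (if o.+1 == L then 0 else o.+1) else (if o is o'.+1 then o' else L.-1).

Lemma shift_pos_lt L s o : o < L -> shift_pos L s o < L.
Proof.
rewrite /shift_pos; case: s; first by case: eqP => [|/eqP]; lia.
by case: o => [|o]; lia.
Qed.

Lemma shift_posK L s o : o < L -> shift_pos L (~~ s) (shift_pos L s o) = o.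
Proof.
rewrite /shift_pos; case: s => /=.
  by case: eqP => [|_]; lia.
case: o => [|o] lt; first by rewrite prednK ?eqxx //; lia.
by case: eqP => // e; lia.
Qed.

Definition phase_succ f := Phase (forward f) (shift_pos_lt (forward f) (position_lt f)).
Definition phase_back f := Phase (~~ forward f) (position_lt f).
Definition phase_label f : letter :=
  if forward f then relator_letter (phase_key f) (position f) else linv (relator_letter (phase_key f) (position (phase_succ f))).

Lemma phase_backK : involutive phase_back.
Proof. by move=> f; apply: phase_eq; rewrite //= negbK. Qed.

Lemma phase_succ_back f : phase_succ (phase_back (phase_succ f)) = phase_back f.
Proof. by apply: phase_eq => //=; rewrite shift_posK ?position_lt. Qed.

Lemma phase_label_back f : phase_label (phase_back (phase_succ f)) = linv (phase_label f).
Proof.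
rewrite /phase_label /=; case: (forward f) => /=; last by rewrite linvK.
by have := shift_posK true (position_lt f) => /= ->.
Qed.

Lemma phase_key_iter j f : phase_key (iter j phase_succ f) = phase_key f.
Proof. by elim: j. Qed.
Lemma forward_iter j f : forward (iter j phase_succ f) = forward f.
Proof. by elim: j. Qed.

Lemma position_forward j f : forward f -> position (iter j phase_succ f) = (position f + j) %% relator_length (phase_key f).
Proof.
move=> sf; elim: j => [|j IH]; first by rewrite addn0 modn_small ?position_lt.
rewrite iterS [position _]/= phase_key_iter forward_iter sf IH (_ : position f + j.+1 = position f + j + 1); last by lia.
rewrite -[in RHS]modnDml addn1 /shift_pos.
have : (position f + j) %% relator_length (phase_key f) < relator_length (phase_key f) by rewrite ltn_mod /relator_length addn1.
move: (_ %% _) => x; case: eqP => [-> _|/eqP n lt]; first by rewrite modnn.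
by rewrite modn_small // ltn_neqAle n.
Qed.

Lemma position_backward j f : ~~ forward f -> position (iter j phase_succ f) + j = position f %[mod relator_length (phase_key f)].
Proof.
move=> sf; elim: j => [|j IH]; first by rewrite addn0.
rewrite -IH iterS [position (phase_succ _)]/= phase_key_iter forward_iter (negbTE sf) /shift_pos.
case: (position _) => [|m]; last by rewrite addSnnS.
by rewrite -addSnnS prednK ?modnDl // /relator_length addn1.
Qed.

Lemma phase_back_iter j f : iter j phase_succ (phase_back (iter j phase_succ f)) = phase_back f.
Proof.
by elim: j f => [|j IH] f //; rewrite iterSr (iterS j phase_succ f) phase_succ_back IH.
Qed.

Lemma phase_succ_inj f g : phase_succ f = phase_succ g -> f = g.
Proof.
by move=> e; have := phase_succ_back f; rewrite e phase_succ_back => /(can_inj phase_backK).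
Qed.

Lemma phase_succ_period f : iter (relator_length (phase_key f)) phase_succ f = f.
Proof.
wlog s : f / forward f.
  move=> th; have [s|s] := boolP (forward f); first exact: th.
  have := th (phase_back f) s; rewrite [phase_key _]/= => e.
  by have := phase_back_iter (relator_length (phase_key f)) (phase_back f); rewrite e phase_backK.
apply: phase_eq; rewrite ?phase_key_iter ?forward_iter //.
by rewrite position_forward // modnDr modn_small ?position_lt.
Qed.

Definition agree w f g := forall j, j < w -> phase_label (iter j phase_succ f) = phase_label (iter j phase_succ g).

(** By [three_centers] a window of this length shows three centers. *)
Definition window k := 16 * (spread (code k) + 2 * Q) + 16.

Lemma phase_label_forward f : forward f -> phase_label f = relator_letter (phase_key f) (position f).
Proof. by rewrite /phase_label => ->. Qed.
Lemma phase_label_backward f : ~~ forward f -> phase_label f = linv (relator_letter (phase_key f) (position (phase_succ f))).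
Proof. by rewrite /phase_label => /negbTE->. Qed.

(** Away from position 0 a relator alternates between two factors. *)
Lemma agree_tag w f g j : forward f -> 0 < position f -> position f + w <= relator_length (phase_key f) ->
  agree w f g -> j + 2 < w ->
  tag (phase_label (iter j phase_succ g)) = tag (phase_label (iter j.+2 phase_succ g)).
Proof.
move=> sf o0 ow ag lj; rewrite -!ag; [|lia|lia].
rewrite !phase_label_forward ?forward_iter // !phase_key_iter !position_forward // !modn_small; [|lia|lia].
by rewrite !relator_tag ?addnS //= ?negbK //; lia.
Qed.

Lemma relator_length_big k : 100 < relator_length k.
Proof. by rewrite /relator_length /mark; have := spread_ge Q (code k); nia. Qed.

(** A phase that spells the same letters also alternates between two factors in this
window, so it avoids the letter of its relator that lies in a third factor. *)
Lemma agree_pos w f g : forward f -> forward g -> 0 < position f -> position f + w <= relator_length (phase_key f) ->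
  2 < w -> agree w f g -> 0 < position g /\ position g + w <= relator_length (phase_key g).
Proof.
move=> sf sg o0 ow w3 ag.
have tg j : j + 2 < w -> tag (phase_label (iter j phase_succ g)) = tag (phase_label (iter j.+2 phase_succ g)).
  exact: agree_tag ag.
have nx j p : p < relator_length (phase_key g) -> position g + j = p \/ position g + j = p + relator_length (phase_key g) ->
    phase_label (iter j phase_succ g) = relator_letter (phase_key g) p.
  move=> lp e; rewrite phase_label_forward ?forward_iter // phase_key_iter position_forward //.
  by case: e => ->; rewrite ?modnDr modn_small.
have l0 := relator_length_big (phase_key g); have lt := position_lt g.
have notg j p : j < w -> 0 < p < relator_length (phase_key g) -> (position g + j = p \/ position g + j = p + relator_length (phase_key g)) ->
    tag (phase_label (iter j phase_succ g)) <> tag (kg (phase_key g)).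
  by move=> jw /andP[p0 pl] /(nx _ _ pl)->; exact: relator_tag_g.
split.
  rewrite lt0n; apply/eqP => e; apply: (notg 2 2); [lia|lia|lia|].
  by rewrite -tg // (nx 0 0) //; lia.
rewrite leqNgt; apply/negP => lt'.
have [j ej] : exists j, position g + j.+1 = relator_length (phase_key g) by exists (relator_length (phase_key g) - position g).-1; lia.
have [j2|j2] := ltnP (j + 2) w.
  have := tg j j2; rewrite (nx j (relator_length (phase_key g)).-1) ?(nx j.+2 1); try lia.
  rewrite !relator_tag //; last by lia.
  have -> : odd (relator_length (phase_key g)).-1 = false by rewrite /relator_length addn1 oddM.
  by have [_ _ [n1 _ _] _] := keyP (phase_key g) => /esym.
apply: (notg j.-1 (relator_length (phase_key g) - 2)); [lia|lia|lia|].
by rewrite tg; [rewrite (nx _ 0) //; lia | lia].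
Qed.

(** The same for a phase that is read backwards; it is described by the position [c]
at which it stands. *)
Lemma agree_neg w f g : forward f -> ~~ forward g -> 0 < position f -> position f + w <= relator_length (phase_key f) ->
  2 < w -> agree w f g ->
  exists c, [/\ w < c, c <= relator_length (phase_key g) &
    forall j, j < w -> phase_label (iter j phase_succ g) = linv (relator_letter (phase_key g) (c - j.+1))].
Proof.
move=> sf sg o0 ow w3 ag.
have tg j : j + 2 < w -> tag (phase_label (iter j phase_succ g)) = tag (phase_label (iter j.+2 phase_succ g)).
  exact: agree_tag ag.
have l0 := relator_length_big (phase_key g); have lt := position_lt g.
have [c [c0 cl ec]] : exists c, [/\ 0 < c, c <= relator_length (phase_key g) & c = position g %[mod relator_length (phase_key g)]].
  have [e|o'0] := posnP (position g); last by exists (position g); split=> //; exact: ltnW.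
  by exists (relator_length (phase_key g)); split=> //; [lia | rewrite e modnn mod0n].
have nx j p : p < relator_length (phase_key g) -> p + j.+1 = c %[mod relator_length (phase_key g)] ->
    phase_label (iter j phase_succ g) = linv (relator_letter (phase_key g) p).
  move=> lp e; rewrite phase_label_backward ?forward_iter // phase_key_iter -iterS; congr linv; congr relator_letter.
  have := position_backward j.+1 sg; rewrite -ec -e => /eqP.
  rewrite eqn_modDr !modn_small // => [/eqP //|].
  by rewrite -(phase_key_iter j.+1 g) position_lt.
have notg j p : j < w -> 0 < p < relator_length (phase_key g) -> p + j.+1 = c %[mod relator_length (phase_key g)] ->
    tag (phase_label (iter j phase_succ g)) <> tag (kg (phase_key g)).
  by move=> jw /andP[p0 pl] /(nx _ _ pl)-> /=; exact: relator_tag_g.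
have wc : w < c.
  rewrite ltnNge; apply/negP => cw; have [j ej] : exists j, c = j.+1 by exists c.-1; lia.
  have [j2|j2] := ltnP j.+1 w.
    have [j0|j0] := posnP j.
      have e0 : tag (phase_label (iter 0 phase_succ g)) = tag (kg (phase_key g)).
        by rewrite (nx 0 0) //; [lia | rewrite ej j0].
      have e2 : 0 + 2 < w by lia.
      apply: (notg 2 (relator_length (phase_key g) - 2)); [lia|lia| |by rewrite -(tg 0 e2)].
      by rewrite ej j0 -(modnDl 1 (relator_length (phase_key g))); congr (_ %% _); lia.
    have := tg j.-1; rewrite prednK // => /(_ ltac:(lia)).
    rewrite (nx j.-1 1) ?(nx j.+1 (relator_length (phase_key g)).-1); [|lia| |lia|by rewrite ej; congr (_ %% _); lia].
      rewrite /= !relator_tag //; last by lia.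
      have -> : odd (relator_length (phase_key g)).-1 = false by rewrite /relator_length addn1 oddM.
      by have [_ _ [n1 _ _] _] := keyP (phase_key g).
    by rewrite ej -(modnDl j.+1 (relator_length (phase_key g))); congr (_ %% _); lia.
  apply: (notg j.-2 2); [lia|lia|by rewrite ej; congr (_ %% _); lia|].
  have -> : tag (kg (phase_key g)) = tag (phase_label (iter j phase_succ g)) by rewrite (nx j 0) //; [lia | rewrite ej].
  have ej2 : j = j.-2.+2 by lia.
  by rewrite [in RHS]ej2 -tg //; lia.
exists c; split=> // j jw; rewrite (nx j (c - j.+1)) //; first by lia.
by congr (_ %% _); lia.
Qed.

(** The centers are visible in the letters, by [before_center] and [after_center], so
the phases can be decoded. *)
Lemma agree_linear f g : forward f -> 0 < position f -> position f + window (phase_key f) <= relator_length (phase_key f) ->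
  agree (window (phase_key f)) f g -> f = g.
Proof.
set w := window (phase_key f) => sf o0 ow ag.
have w3 : 20 < w by rewrite /w /window; have := spread_ge Q (code (phase_key f)); lia.
have w2 : 2 < w by lia.
have lf j : j < w -> phase_label (iter j phase_succ f) = relator_letter (phase_key f) (position f + j).
  by move=> jw; rewrite phase_label_forward ?forward_iter // phase_key_iter position_forward // modn_small //; lia.
have startf j : 2 <= j -> j + 4 < w ->
   (exists2 s, s < Q & position f + j + 3 = center (code (phase_key f)) s) <->
   (phase_label (iter j phase_succ g) <> phase_label (iter (j + 4) phase_succ g) /\
    phase_label (iter (j - 2) phase_succ g) = phase_label (iter (j + 2) phase_succ g)).
  move=> j2 j4; rewrite -!ag; try lia; rewrite !lf; try lia.
  rewrite -before_center; last by lia.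
  by rewrite !addnA addnBA.
have [sg|sg] := boolP (forward g).
  have [o0' ow'] := agree_pos sf sg o0 ow w2 ag.
  have lg j : j < w -> phase_label (iter j phase_succ g) = relator_letter (phase_key g) (position g + j).
    by move=> jw; rewrite phase_label_forward ?forward_iter // phase_key_iter position_forward // modn_small //; lia.
  have [|/code_inj ek eo] := @decode_translation _ Q_big (code (phase_key f)) (code (phase_key g)) (position f) (position g) w o0 ow (leqnn _).
    move=> j j2 j4; rewrite startf // !lg; try lia.
    rewrite -before_center; last by lia.
    by rewrite !addnA addnBA.
  by apply: phase_eq => //; rewrite sf sg.
have [c [wc cl lg]] := agree_neg sf sg o0 ow w2 ag.
(* Steps [j] and [j + 4] read the positions [c - j - 1] and [c - j - 5]; by
   [after_center] a change between them belongs to the center [c - 8 - j]. *)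
case: (@decode_reflection _ Q_big (code (phase_key f)) (code (phase_key g)) (position f) (c - 8) w o0 ow (leqnn _)).
move=> j j2 j4; rewrite startf // !lg; try lia.
have li (a b : letter) : linv a = linv b <-> a = b by split=> [/linv_inj|->].
rewrite !li; have := after_center (phase_key g) (p := c - (j + 5)) ltac:(lia).
have -> : c - (j + 5) + 4 = c - j.+1 by lia.
have -> : c - (j + 5) + 2 = c - (j + 2).+1 by lia.
have -> : c - (j + 5) + 6 = c - (j - 2).+1 by lia.
have -> : c - (j + 4).+1 = c - (j + 5) by lia.
move=> e; split=> [[n1 n2]|[s sQ es]].
  have /e[s sQ es] : relator_letter (phase_key g) (c - (j + 5)) <> relator_letter (phase_key g) (c - j.+1) /\
     relator_letter (phase_key g) (c - (j + 2).+1) = relator_letter (phase_key g) (c - (j - 2).+1).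
    by split=> // /esym.
  by exists s => //; lia.
have /e[n1 n2] : exists2 s, s < Q & c - (j + 5) = center (code (phase_key g)) s + 3.
  by exists s => //; lia.
by split=> // /esym.
Qed.

Lemma agree_shift k w f g : agree (k + w) f g -> agree w (iter k phase_succ f) (iter k phase_succ g).
Proof. by move=> ag j jw; rewrite -!iterD; apply: ag; rewrite addnC ltn_add2l. Qed.

Lemma iter_phase_succ_inj k f g : iter k phase_succ f = iter k phase_succ g -> f = g.
Proof. by elim: k => //= k IH /phase_succ_inj/IH. Qed.

Lemma agree_le w w' f g : w' <= w -> agree w f g -> agree w' f g.
Proof. by move=> le ag j jw; apply: ag; exact: leq_trans jw le. Qed.

Lemma agree_back w f g : agree w f g ->
  agree w (phase_back (iter w phase_succ f)) (phase_back (iter w phase_succ g)).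
Proof.
move=> ag j jw.
have e h : phase_label (iter j phase_succ (phase_back (iter w phase_succ h))) = linv (phase_label (iter (w - j.+1) phase_succ h)).
  have -> : w = j + (w - j.+1).+1 by lia.
  by rewrite iterD phase_back_iter iterS phase_label_back; congr (linv (phase_label (iter _ _ _))); lia.
by rewrite !e ag //; lia.
Qed.

(** A window that runs across position 0 decodes nothing, but one of two successive
windows avoids it. *)
Definition phase_piece f := 2 * window (phase_key f) + 2.

(** A piece has length at most [65 * spread], and a relator has length at least
[4 * Q * spread]; hence the bound 2000 for [Q]. *)
Lemma phase_piece_small f : 100 * phase_piece f <= relator_length (phase_key f).
Proof.
rewrite /phase_piece /window /relator_length /mark; have := spread_ge Q (code (phase_key f)).
move: (spread _) => A; nia.
Qed.

(** Advance both phases until a window avoids position 0.  A phase that is read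
backwards is turned around at the end of this window. *)
Lemma agree_eq f g : agree (phase_piece f) f g -> f = g.
Proof.
set w := window (phase_key f) => ag; have lw : 100 * (2 * w + 2) <= relator_length (phase_key f) := phase_piece_small f.
have lt := position_lt f.
have [sf|sf] := boolP (forward f).
  have [k [kw o0 ow]] : exists k, [/\ k <= w + 1, 0 < (position f + k) %% relator_length (phase_key f) &
      (position f + k) %% relator_length (phase_key f) + w <= relator_length (phase_key f)].
    have [e|o0] := posnP (position f).
      by exists 1; rewrite e modn_small; [split; lia | lia].
    have [ow|ow] := leqP (position f + w) (relator_length (phase_key f)).
      by exists 0; rewrite addn0 modn_small; [split; lia | lia].
    exists (relator_length (phase_key f) - position f + 1).
    by have -> : position f + (relator_length (phase_key f) - position f + 1) = 1 + relator_length (phase_key f); [lia | rewrite modnDr modn_small; [split; lia | lia]].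
  apply: (@iter_phase_succ_inj k); apply: agree_linear.
  - by rewrite forward_iter.
  - by rewrite position_forward.
  - by rewrite position_forward // phase_key_iter.
  - by rewrite phase_key_iter; apply: agree_shift; apply: agree_le ag; rewrite /phase_piece -/w; lia.
have pom j x h : ~~ forward h -> x < relator_length (phase_key h) -> x + j = position h %[mod relator_length (phase_key h)] ->
    position (iter j phase_succ h) = x.
  move=> sh xl e; have := position_backward j sh; rewrite -e => /eqP.
  by rewrite eqn_modDr !modn_small // => [/eqP //|]; rewrite -(phase_key_iter j h) position_lt.
have [k [kw ow]] : exists k, k <= w + 1 /\ w < position (iter k phase_succ f).
  have [ow|ow] := leqP (position f) w; last by exists 0; split=> //; lia.
  exists (position f).+1; split; first by lia.
  rewrite (pom _ (relator_length (phase_key f)).-1) //; [lia|lia|].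
  by rewrite -(modnDl (position f) (relator_length (phase_key f))); congr (_ %% _); lia.
apply: (@iter_phase_succ_inj k); have : agree w (iter k phase_succ f) (iter k phase_succ g).
  by apply: agree_shift; apply: agree_le ag; rewrite /phase_piece -/w; lia.
have sk : ~~ forward (iter k phase_succ f) by rewrite forward_iter.
have ew : w = window (phase_key (iter k phase_succ f)) by rewrite phase_key_iter.
move: (iter k phase_succ f) (iter k phase_succ g) ow sk ew => f1 g1 ow sf1 ew ag1.
have ep : position (iter w phase_succ f1) = position f1 - w.
  by apply: pom => //; [have := position_lt f1; lia | rewrite subnK // ltnW].
apply: (@iter_phase_succ_inj w); apply: (can_inj phase_backK); apply: agree_linear => /=.
- by rewrite forward_iter.
- by rewrite ep subn_gt0.
- by rewrite phase_key_iter -ew ep subnK ltnW // position_lt.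
- by rewrite phase_key_iter -ew; exact: agree_back.
Qed.

Lemma phase_label_alt f : tag (phase_label (phase_succ f)) <> tag (phase_label f).
Proof.
have l0 := relator_length_big (phase_key f); have lt := position_lt f.
have alt o : o < relator_length (phase_key f) ->
    tag (relator_letter (phase_key f) (shift_pos (relator_length (phase_key f)) true o)) <> tag (relator_letter (phase_key f) o).
  move=> ol; rewrite /shift_pos; case: eqP => [eo|/eqP no].
    by rewrite relator_tag0 => /esym; apply: relator_tag_g; lia.
  by have [->|o0] := posnP o; [exact: relator_tag_g | move/esym; exact: relator_tag_alt].
have [sf|sf] := boolP (forward f).
  by rewrite !phase_label_forward //= sf; exact: alt.
rewrite !phase_label_backward //= (negbTE sf).
have := alt _ (shift_pos_lt false (shift_pos_lt false lt)).
have := shift_posK false (shift_pos_lt false lt) => /= ->.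
by move=> n /esym.
Qed.

Lemma phase_label_neq1 f : tagged (phase_label f) <> 1%g.
Proof.
rewrite /phase_label; case: ifP => _ /=; first exact: relator_neq1.
by move=> e; apply: (@relator_neq1 (phase_key f) (position (phase_succ f))); rewrite -[LHS]invgK e invg1.
Qed.

Lemma phase_piece_gt0 f : 0 < phase_piece f.
Proof. by rewrite /phase_piece addn2. Qed.

Definition relators : relatorSystem H := @RelatorSystem _ _ relator_phase phase_succ phase_back phase_label
  (fun f => relator_length (phase_key f)) phase_piece forward phase_backK phase_succ_back phase_label_back phase_label_neq1 phase_label_alt
  (fun _ => erefl) (fun _ => erefl) (fun _ => erefl) (fun _ => erefl)
  (fun _ => erefl) (fun _ => erefl) phase_succ_period phase_piece_gt0 phase_piece_small agree_eq.

End Relators.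

(** * Groups presented by a congruence on words *)

Local Open Scope classical_set_scope.

Section Congruences.
Context (J : Type) (H : J -> groupType).
Local Notation word := (seq (letter H)).
Implicit Types (u v w : word) (l : letter H).

Record congruence (C : word -> word -> Prop) : Prop := Congruence {
  cong_refl : forall u, C u u;
  cong_sym : forall u v, C u v -> C v u;
  cong_trans : forall u v w, C u v -> C v w -> C u w;
  cong_cat : forall u u' v v', C u u' -> C v v' -> C (u ++ v) (u' ++ v');
  cong_mul : forall i (a b : H i), C [:: existT _ i a; existT _ i b] [:: existT _ i (a * b)%g];
  cong_one : forall i, C [:: existT _ i (1%g : H i)] [::]
}.

Definition winv w : word := rev (map (@linv _ H) w).

Section Quotient.
Context (C : word -> word -> Prop) (cC : congruence C).

(** The proof that [C] is a congruence is a parameter of the type, since the group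
structure depends on it. *)
Definition quotient_by of congruence C := {X : set word | exists w, X = C w}.
Local Notation quot := (quotient_by cC).
HB.instance Definition _ := gen_eqMixin quot.
HB.instance Definition _ := gen_choiceMixin quot.

Lemma quotient_eq (x y : quot) : sval x = sval y -> x = y.
Proof.
by case: x y => [X p] [Y q] /= e; subst; congr exist; exact: Prop_irrelevance.
Qed.

Definition word_class w : quot := exist _ (C w) (ex_intro _ w erefl).
Definition class_word (x : quot) : word := projT1 (cid (proj2_sig x)).

Lemma word_class_eq u v : word_class u = word_class v <-> C u v.
Proof.
split=> [/(congr1 (@proj1_sig _ _)) /= e|e]; first by rewrite e; exact: cong_refl.
apply: quotient_eq; apply/funext => w; apply/propext.
by split; apply: (cong_trans cC) => //; exact: cong_sym.
Qed.

Lemma class_wordK x : word_class (class_word x) = x.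
Proof. by rewrite /class_word; case: cid => w e; apply: quotient_eq. Qed.

Lemma class_word_class w : C (class_word (word_class w)) w.
Proof. by apply/word_class_eq; rewrite class_wordK. Qed.

Lemma quotient_ind (P : quot -> Prop) : (forall w, P (word_class w)) -> forall x, P x.
Proof. by move=> Pw x; rewrite -(class_wordK x). Qed.

Lemma linv_cancel l : C [:: linv l; l] [::].
Proof.
case: l => i a; apply: (cong_trans cC (cong_mul cC _ _)).
by rewrite mulVg; exact: cong_one.
Qed.

Lemma cong_mid u v w w' : C w w' -> C (u ++ w ++ v) (u ++ w' ++ v).
Proof.
by move=> c; apply: (cong_cat cC (cong_refl cC _)); apply: (cong_cat cC c (cong_refl cC _)).
Qed.

Lemma winvV w : C (winv w ++ w) [::].
Proof.
elim: w => [|l w IH]; first exact: cong_refl.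
rewrite /winv /= rev_cons cat_rcons.
exact: (cong_trans cC (cong_mid (winv w) w (linv_cancel l)) IH).
Qed.

Lemma winvK : involutive winv.
Proof. by move=> w; rewrite /winv map_rev revK mapK //; exact: linvK. Qed.

Lemma winvR w : C (w ++ winv w) [::].
Proof. by have := winvV (winv w); rewrite winvK. Qed.

Lemma cong_winv u v : C u v -> C (winv u) (winv v).
Proof.
move=> c; apply: (cong_trans cC (v := winv u ++ v ++ winv v)).
  have := cong_mid (winv u) [::] (cong_sym cC (winvR v)).
  by rewrite !cats0.
have c' : C (winv u ++ v ++ winv v) (winv u ++ u ++ winv v).
  exact: cong_mid (cong_sym cC c).
apply: (cong_trans cC c'); rewrite catA.
by have := cong_mid [::] (winv v) (winvV u).
Qed.

Definition qmul x y := word_class (class_word x ++ class_word y).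
Definition qinv x := word_class (winv (class_word x)).

Lemma qmulE u v : qmul (word_class u) (word_class v) = word_class (u ++ v).
Proof. by apply/word_class_eq; apply: (cong_cat cC); exact: class_word_class. Qed.
Lemma qinvE u : qinv (word_class u) = word_class (winv u).
Proof. by apply/word_class_eq; apply: cong_winv; exact: class_word_class. Qed.

Lemma qmulA : associative qmul.
Proof.
apply: quotient_ind => u; apply: quotient_ind => v; apply: quotient_ind => w.
by rewrite !qmulE catA.
Qed.
Lemma qmul1 : left_id (word_class [::]) qmul.
Proof. by apply: quotient_ind => u; rewrite qmulE. Qed.
Lemma qmulr1 : right_id (word_class [::]) qmul.
Proof. by apply: quotient_ind => u; rewrite qmulE cats0. Qed.
Lemma qmulV : left_inverse (word_class [::]) qinv qmul.
Proof. by apply: quotient_ind => u; rewrite qinvE qmulE; apply/word_class_eq; exact: winvV. Qed.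
Lemma qmulrV : right_inverse (word_class [::]) qinv qmul.
Proof. by apply: quotient_ind => u; rewrite qinvE qmulE; apply/word_class_eq; exact: winvR. Qed.

HB.instance Definition _ := isGroup.Build quot qmulA qmul1 qmulr1 qmulV qmulrV.

Lemma word_class_cat u v : word_class (u ++ v) = (word_class u * word_class v)%g.
Proof. by rewrite -qmulE. Qed.
Definition factor_map i (h : H i) : quot := word_class [:: existT _ i h].

Lemma factor_mapM i : {morph @factor_map i : a b / (a * b)%g >-> (a * b)%g}.
Proof.
by move=> a b; rewrite /factor_map -word_class_cat; apply/word_class_eq; apply: cong_sym => //; exact: cong_mul.
Qed.
HB.instance Definition _ i := isMultiplicative.Build (H i) quot (@factor_map i) (@factor_mapM i).

End Quotient.
End Congruences.

(** * A maximal congruence and its simple quotient *)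

Section Simple.
Context (J : Type) (H : J -> groupType) (enc : letter H -> nat).
Context (enc_inj : injective enc) (Q : nat) (Q_big : 2000 <= Q).
Local Notation word := (seq (letter H)).
Local Notation relator_system := (relators enc_inj Q_big).
Local Notation block_letter := (block_letter enc Q).
Implicit Types (u v w : word) (l : letter H) (k : key H).

Definition word_act w (p : point H) := foldr (fun l => act relator_system (tagged l)) p w.

Lemma word_act_cat u v p : word_act (u ++ v) p = word_act u (word_act v p).
Proof. by rewrite /word_act foldr_cat. Qed.

Definition same_act u v := forall p, word_act u p = word_act v p.

Lemma same_act_congruence : congruence same_act.
Proof.
split=> [u p|u v e p|u v w e e' p|u u' v v' e e' p|i a b p|i p].
- by [].
- by rewrite e.
- by rewrite e.
- by rewrite !word_act_cat e' e.
- by rewrite /= actM.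
- by rewrite /= act1.
Qed.

(** The action of each factor is free. *)
Lemma same_act_letter l : same_act [:: l] [::] -> tagged l = 1%g.
Proof. by move=> h; exact: act_free (h [::]). Qed.

Fixpoint blocks k n : word :=
  if n is m.+1 then [:: linv (block_letter k m); kx k; block_letter k m; kx k] ++ blocks k m
  else [::].

(** The phase that reads a relator forwards from position 0. *)
Definition relator_start k : relator_system := @Phase _ _ enc Q k true 0 (leq_ltn_trans (leq0n 100) (relator_length_big enc Q_big k)).

Lemma label_start k j : j < relator_length enc Q k -> label (iter j succ (relator_start k)) = relator_letter enc Q k j.
Proof.
move=> lt; change (phase_label Q_big (iter j (phase_succ Q_big) (relator_start k)) = relator_letter enc Q k j).
by rewrite phase_label_forward ?forward_iter // phase_key_iter position_forward //= add0n modn_small.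
Qed.

Lemma trace_rcons j (f : relator_system) p :
  trace j.+1 f p = act relator_system (tagged (label (iter j succ f))) (trace j f p).
Proof. by elim: j f p => [|j IH] f p //; rewrite iterSr [RHS]/= -IH. Qed.

(** The letter read first acts first and is therefore the last one of the word;
this is why [blocks] puts new blocks in front. *)
Lemma trace_blocks k p n : 4 * n < relator_length enc Q k ->
  trace (4 * n + 1) (relator_start k) p = word_act (blocks k n) (act relator_system (tagged (linv (kg k))) p).
Proof.
elim: n => [|n IH] lt.
  by rewrite trace_rcons label_start.
have -> : 4 * n.+1 + 1 = (4 * n + 1).+4 by lia.
rewrite !trace_rcons IH; last by lia.
rewrite !label_start; try by lia.
rewrite addn1 /= !oddM /=.
have -> : (4 * n).+1 %% 4 = 1 by lia.
have -> : (4 * n).+3 %% 4 = 3 by lia.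
have -> : (4 * n).+1 %/ 4 = n by lia.
have -> : (4 * n).+3 %/ 4 = n by lia.
by [].
Qed.

Lemma relation k : same_act (blocks k (mark Q (code enc k) Q)) [:: kg k].
Proof.
move=> p; have := trace_relator (relator_start k) (act relator_system (tagged (kg k)) p).
rewrite [len _](_ : _ = relator_length enc Q k) // trace_blocks; last by rewrite /relator_length addn1.
by rewrite -actM mulVg act1.
Qed.

(** The factor can play the part of [y] and [z] in a relator. *)
Definition ample j := exists y z : H j, [/\ y <> 1%g, z <> 1%g & y <> z].

Section Deletion.
Context (C : word -> word -> Prop) (cC : congruence C).
Context (sC : forall u v, same_act u v -> C u v).

Lemma key_of (i j m : J) (x : H i) (g : H m) : i <> j -> ample j -> m <> i -> m <> j ->
  x <> 1%g -> g <> 1%g ->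
  exists k, [/\ kx k = existT _ i x, kg k = existT _ m g & tag (ky k) = j].
Proof.
move=> ij [y [z [y1 z1 yz]]] mi mj x1 g1.
have v : valid_key (existT _ i x) (existT _ j y) (existT _ j z) (existT _ m g).
  by split=> //= e; exact: yz (letter_inj e).
by exists (Key v).
Qed.

(** Without its letters [x], a block is [b^-1 b]. *)
Lemma trivial_blocks k n : C [:: kx k] [::] -> C (blocks k n) [::].
Proof.
move=> x1; elim: n => [|n IH] /=; first exact: cong_refl.
set b := block_letter k n.
apply: (cong_trans cC (v := [:: linv b; b])); last exact: linv_cancel.
have := cong_cat cC (cong_refl cC [:: linv b])
  (cong_cat cC x1 (cong_cat cC (cong_refl cC [:: b]) (cong_cat cC x1 IH))).
by [].
Qed.

Lemma trivial_spread (x g : letter H) j : C [:: x] [::] -> tagged x <> 1%g ->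
  tag x <> j -> ample j -> tag g <> tag x -> tag g <> j -> C [:: g] [::].
Proof.
case: x g => [i x] [m g] /= Cx x1 ij aj mi mj.
have [->|g1] := EM (g = 1%g); first exact: cong_one.
have [k [ex eg _]] := key_of ij aj mi mj x1 g1; rewrite -eg.
apply: (cong_trans cC (cong_sym cC (sC (relation k)))).
by apply: trivial_blocks; rewrite ex.
Qed.

Context (e : 'I_3 -> J) (e_inj : injective e) (e_ample : forall t, ample (e t)).

Lemma avoid (a b : J) : exists t, e t <> a /\ e t <> b.
Proof.
apply: contrapT => no.
have h t : e t = a \/ e t = b.
  have [->|na] := EM (e t = a); first by left.
  by have [->|nb] := EM (e t = b); [right | case: no; exists t].
have d s t : s != t -> e s = e t -> False by move=> /eqP n /e_inj.
have d01 := d (inord 0) (inord 1); have d02 := d (inord 0) (inord 2).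
have d12 := d (inord 1) (inord 2).
have ne m n : m < 3 -> n < 3 -> (inord m == inord n :> 'I_3) = (m == n).
  by move=> lm ln; rewrite -val_eqE /= !inordK.
rewrite !ne // in d01 d02 d12.
case: (h (inord 0)) (h (inord 1)) (h (inord 2)) => e0 [] e1 [] e2.
all: by rewrite e0 e1 e2 in d01 d02 d12; auto.
Qed.

(** By [trivial_spread], a trivial letter [x] kills every factor that differs
from its own and from some auxiliary ample factor.  Three ample factors leave
enough choice to reach all factors but the one of [x], and then, starting from a
letter killed in this way, this last one too. *)
Lemma trivial_all x : C [:: x] [::] -> tagged x <> 1%g -> forall g, C [:: g] [::].
Proof.
move=> Cx x1.
have others g : tag g <> tag x -> C [:: g] [::].
  move=> gx; have [t [tx tg]] := avoid (tag x) (tag g).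
  by apply: (trivial_spread Cx x1 (j := e t)) => //; exact: nesym.
move=> g; have [gx|] := EM (tag g = tag x); last exact: others.
have [t [tx _]] := avoid (tag x) (tag x).
have [y [_ [y1 _ _]]] := e_ample t.
have [s [sx st]] := avoid (tag x) (e t).
apply: (@trivial_spread (existT _ (e t) y) g (e s)) => //=.
- exact: others.
- exact: nesym.
- by rewrite gx; exact: nesym.
- by rewrite gx; exact: nesym.
Qed.
End Deletion.

Context (e : 'I_3 -> J) (e_inj : injective e) (e_ample : forall t, ample (e t)).

Section Maximal.
Context (c0 : letter H) (c0_neq1 : tagged c0 <> 1%g).

Definition admissible (C : word -> word -> Prop) :=
  [/\ congruence C, forall u v, same_act u v -> C u v & ~ C [:: c0] [::]].

(** Joining [same_act] to a set of pairs makes the empty set admissible, so that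
chains need not be assumed nonempty. *)
Definition adjoin (A : set (word * word)) u v := same_act u v \/ A (u, v).

Lemma adjoin0 : admissible (adjoin set0).
Proof.
have -> : adjoin set0 = same_act.
  by apply/funext => u; apply/funext => v; apply/propext; split=> [[]|]; [| |left].
split=> //; first exact: same_act_congruence.
by move/same_act_letter.
Qed.

(** Each closure property involves at most two related pairs, and these belong to one
member of the chain. *)
Lemma adjoin_bigcup (F : set (set (word * word))) :
  F `<=` [set A | admissible (adjoin A)] -> total_on F subset ->
  admissible (adjoin (\bigcup_(X in F) X)).
Proof.
move=> FP Ft.
have cover u v u' v' : adjoin (\bigcup_(X in F) X) u v ->
    adjoin (\bigcup_(X in F) X) u' v' -> exists A, [/\ admissible (adjoin A),
      A `<=` \bigcup_(X in F) X, adjoin A u v & adjoin A u' v'].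
  move=> [s|[X FX Xu]] [s'|[Y FY Yu]].
  - by exists set0; split; [exact: adjoin0 | exact: sub0set | left | left].
  - by exists Y; split; [exact: FP | exact: bigcup_sup | left | right].
  - by exists X; split; [exact: FP | exact: bigcup_sup | right | left].
  - case: (Ft X Y FX FY) => XY.
      by exists Y; split; [exact: FP | exact: bigcup_sup | right; exact: XY | right].
    by exists X; split; [exact: FP | exact: bigcup_sup | right | right; exact: XY].
have up A u v : A `<=` \bigcup_(X in F) X -> adjoin A u v -> adjoin (\bigcup_(X in F) X) u v.
  by move=> sA [s|/sA a]; [left | right].
have base u v : same_act u v -> adjoin (\bigcup_(X in F) X) u v by left.
have cs := same_act_congruence.
split=> [||a]; last 1 first.
- by have [A [[_ _ n] _ a' _]] := cover _ _ _ _ a a.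
- split.
  + by move=> u; apply: base; exact: cong_refl.
  + move=> u v a; have [A [[c _ _] sA a' _]] := cover _ _ _ _ a a.
    by apply: (up _ _ _ sA); exact: cong_sym.
  + move=> u v w a b; have [A [[c _ _] sA a' b']] := cover _ _ _ _ a b.
    by apply: (up _ _ _ sA); exact: (cong_trans c a').
  + move=> u u' v v' a b; have [A [[c _ _] sA a' b']] := cover _ _ _ _ a b.
    by apply: (up _ _ _ sA); exact: (cong_cat c).
  + by move=> i a b; apply: base; exact: (cong_mul cs).
  + by move=> i; apply: base; exact: (cong_one cs).
- exact: base.
Qed.

Lemma maximal_congruence : exists2 C, admissible C &
  forall D, admissible D -> (forall u v, C u v -> D u v) -> forall u v, D u v -> C u v.
Proof.
have [A [adA maxA]] := Zorn_bigcup adjoin_bigcup.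
exists (adjoin A) => // D adD CD u v Duv.
have [_ sD _] := adD.
have sub : A `<=` [set x | D x.1 x.2] by move=> [a b] Aab; apply: CD; right.
apply: contrapT => nC; apply: (maxA [set x | D x.1 x.2]).
  split=> // /(_ (u, v) Duv) a; by apply: nC; right.
suff e' : adjoin [set x | D x.1 x.2] = D by rewrite /mkset e'.
apply/funext => a; apply/funext => b; apply/propext.
by split=> [[/sD|]|]; [| |right].
Qed.
End Maximal.

Lemma subgroupP (G : groupType) (K : set G) : subgroup K <->
  [/\ K 1%g, forall x y, K x -> K y -> K (x * y)%g & forall x, K x -> K x^-1%g].
Proof.
split=> [[/set_mem K1 KV]|[K1 KM KV]].
  have V x : K x -> K x^-1%g.
    by move=> Kx; have := KV 1%g x (mem_set K1) (mem_set Kx); rewrite mul1g => /set_mem.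
  split=> // x y Kx Ky.
  by have := KV x y^-1%g (mem_set Kx) (mem_set (V _ Ky)); rewrite invgK => /set_mem.
split; first exact: mem_set.
by move=> x y /set_mem Kx /set_mem Ky; apply/mem_set; exact: KM (KV _ _).
Qed.

(** A normal subgroup [N] defines a coarser congruence.  If it kills the letter
[c0], it kills all letters and [N] is everything; if not, it is the given
congruence by maximality, and [N] is trivial. *)
Lemma quotient_simple (c0 : letter H) C (cC : congruence C) :
  tagged c0 <> 1%g -> (forall u v, same_act u v -> C u v) -> ~ C [:: c0] [::] ->
  (forall D, admissible c0 D -> (forall u v, C u v -> D u v) -> forall u v, D u v -> C u v) ->
  simple_group (quotient_by cC).
Proof.
move=> c1 sC nC maxC; split; first by exists (word_class cC [:: c0]) => /word_class_eq.
move=> N [/subgroupP[N1 NM NV] NJ].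
pose D u v := N (word_class cC u * (word_class cC v)^-1)%g.
have CD u v : C u v -> D u v by move/(word_class_eq cC) => e'; rewrite /D e' mulgV.
have cD : congruence D.
  split=> [u|u v Duv|u v w Duv Dvw|u u' v v' Du Dv|i a b|i].
  - by apply: CD; exact: cong_refl.
  - by have := NV _ Duv; rewrite invMg invgK.
  - by have := NM _ _ Duv Dvw; rewrite -mulgA mulKg.
  - have := NM _ _ Du (NJ _ (word_class cC u')^-1%g Dv).
    by rewrite /D /conjg !word_class_cat invMg invgK !mulgA mulgKV.
  - by apply: CD; exact: cong_mul.
  - by apply: CD; exact: cong_one.
have [Dc|nD] := EM (D [:: c0] [::]).
  have Dall := trivial_all cD (fun u v s => CD _ _ (sC _ _ s)) e_inj e_ample Dc c1.
  right; apply/seteqP; split=> // + _; apply: quotient_ind => w.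
  have : D w [::].
    elim: w => [|l w IH]; first by apply: CD; exact: cong_refl.
    exact: (cong_cat cD (Dall l) IH).
  by rewrite /D [word_class cC [::]](_ : _ = 1%g) // invg1 mulg1.
left; have adD : admissible c0 D by split=> // u v s; apply: CD; exact: sC.
apply/seteqP; split=> [x|x ->//]; elim/quotient_ind: x => w Nw /=.
rewrite -[RHS]/(word_class cC [::]); apply/word_class_eq; apply: maxC adD CD _ _ _.
by rewrite /D [word_class cC [::]](_ : _ = 1%g) // invg1 mulg1.
Qed.

Section Generation.
Context (C : word -> word -> Prop) (cC : congruence C).
Context (sC : forall u v, same_act u v -> C u v).

(** A letter of any third factor is the value of a product of blocks whose letters
lie in the two given factors. *)
Lemma two_factors_generate (K : set (quotient_by cC)) i j (x : H i) : i <> j -> x <> 1%g -> ample j ->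
  subgroup K -> (forall a : H i, K (factor_map cC a)) -> (forall b : H j, K (factor_map cC b)) ->
  forall s, K s.
Proof.
move=> ij x1 aj /subgroupP[K1 KM KV] Ki Kj.
have Kcat u v : K (word_class cC u) -> K (word_class cC v) -> K (word_class cC (u ++ v)).
  by move=> Ku Kv; rewrite word_class_cat; exact: KM.
have Kl l : tag l = i \/ tag l = j -> K (word_class cC [:: l]).
  by case: l => m h /= [e'|e']; subst m; [exact: Ki | exact: Kj].
have Kall l : K (word_class cC [:: l]).
  have [e'|ni] := EM (tag l = i); first by apply: Kl; left.
  have [e'|nj] := EM (tag l = j); first by apply: Kl; right.
  case: l ni nj => m g /= mi mj.
  have [->|g1] := EM (g = 1%g).
    suff -> : word_class cC [:: existT _ m (1%g : H m)] = 1%g by [].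
    by rewrite -[RHS]/(word_class cC [::]); apply/word_class_eq; exact: cong_one.
  have [k [ex eg ey]] := key_of ij aj mi mj x1 g1.
  rewrite -eg -(proj2 (word_class_eq cC _ _) (sC (relation k))).
  have Kx : K (word_class cC [:: kx k]) by apply: Kl; left; rewrite ex.
  elim: mark => [|n IH] //=; set b := block_letter k n.
  have tb : tag b = j by rewrite /b block_letter_tag.
  have Kb : K (word_class cC [:: b]) by apply: Kl; right.
  have Kb' : K (word_class cC [:: linv b]) by apply: Kl; right.
  exact: Kcat Kb' (Kcat _ _ Kx (Kcat _ _ Kb (Kcat _ _ Kx IH))).
apply: quotient_ind; elim=> [|l w IH] //.
exact: Kcat [:: l] w (Kall l) IH.
Qed.
End Generation.

(** If a congruence identified two elements of one factor, it would kill the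
nontrivial letter formed by their quotient, and then all letters. *)
Theorem simple_embedding : exists (S : groupType) (phi : forall j, {multiplicative H j -> S}),
  [/\ simple_group S, forall j, injective (phi j)
    & forall (K : set S) i j (x : H i), i <> j -> x <> 1%g -> ample j -> subgroup K ->
      (forall a, K (phi i a)) -> (forall b, K (phi j b)) -> forall s, K s].
Proof.
have [y [_ [y1 _ _]]] := e_ample ord0.
pose c0 : letter H := existT _ (e ord0) y.
have c01 : tagged c0 <> 1%g by [].
have [C [cC sC nC] maxC] := maximal_congruence c01.
exists (quotient_by cC), (fun j => @factor_map _ _ _ cC j).
split.
- exact: quotient_simple c01 sC nC maxC.
- move=> j a b /word_class_eq Cab.
  have : C [:: existT _ j (a * b^-1)%g] [::].
    apply: (cong_trans cC (cong_sym cC (cong_mul cC _ _))).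
    have := cong_cat cC Cab (cong_refl cC [:: existT _ j b^-1%g]) => /= h.
    apply: (cong_trans cC h); apply: (cong_trans cC (cong_mul cC _ _)).
    by rewrite mulgV; exact: cong_one.
  move=> Cl; have [/divg1_eq //|n1] := EM ((a * b^-1)%g = 1%g).
  have all := trivial_all cC sC e_inj e_ample Cl n1.
  by case: nC; exact: all.
- by move=> K i j x; exact: two_factors_generate.
Qed.

End Simple.

(** * Adding three cyclic groups of order three *)

Local Open Scope card_scope.
Local Open Scope group_scope.

Lemma countable_letters (J : Type) (H : J -> groupType) :
  countable [set: J] -> (forall j, countable [set: H j]) ->
  exists enc : letter H -> nat, injective enc.
Proof.
move=> /countable_injP[f f_inj] cH.
have [g g_inj] : exists g : forall j, H j -> nat, forall j, injective (g j).
  have ex j : exists g : H j -> nat, injective g.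
    by have /countable_injP[g g_inj] := cH j; exists g => a b; apply: g_inj; exact: mem_set.
  by exists (fun j => projT1 (cid (ex j))) => j; exact: projT2 (cid (ex j)).
exists (fun l => pickle (f (tag l), g (tag l) (tagged l))).
move=> [i a] [j b] /(pcan_inj pickleK) [/= eij].
have {eij} eij : i = j by apply: f_inj eij; exact: mem_set.
by subst j => /g_inj->.
Qed.

Lemma ample_card (J : Type) (H : J -> groupType) j : `I_3 #<= [set: H j] -> ample H j.
Proof.
move=> /card_leP[f0]; have [f _ f_inj] : exists2 f : nat -> H j, set_fun `I_3 [set: H j] f & set_inj `I_3 f.
  by apply/injfunPex; squash (valLR 1 f0).
have fI m n : m < 3 -> n < 3 -> f m = f n -> m = n.
  by move=> lm ln; apply: f_inj; exact: mem_set.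
have d01 : f 0%N <> f 1%N by move/fI; lia.
have d02 : f 0%N <> f 2%N by move/fI; lia.
have d12 : f 1%N <> f 2%N by move/fI; lia.
have [e0|n0] := EM (f 0%N = 1).
  by exists (f 1%N), (f 2%N); split=> // e; [apply: d01 | apply: d02]; rewrite e0 e.
have [e1|n1] := EM (f 1%N = 1).
  by exists (f 0%N), (f 2%N); split=> // e; apply: d12; rewrite e1 e.
by exists (f 0%N), (f 1%N).
Qed.

Lemma generatesI (G : groupType) (A : set G) :
  (forall K, subgroup K -> A `<=` K -> forall s, K s) -> generates A.
Proof. by move=> h; apply/seteqP; split=> // s _ K [sK AK]; exact: h. Qed.

Section Extension.
Context (I : Type) (H : I -> groupType).
Definition C3 : groupType := 'I_3.
(** [trivial_all] needs three ample factors, and the given family may have a single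
one.  Two of the added factors also provide the two generators. *)
Definition extended (j : I + 'I_3) : groupType := if j is inl i then H i else C3.
Definition gen3 : C3 := (inord 1 : 'I_3).

Lemma gen3_neq1 : gen3 <> 1.
Proof. by move/(congr1 val); rewrite /= inordK. Qed.

Lemma gen3_sqr : gen3 * gen3 = (inord 2 : 'I_3).
Proof. by apply/val_inj; rewrite /= !inordK. Qed.

Lemma gen3P (g : C3) : [\/ g = gen3, g = gen3 * gen3 | g = gen3 * (gen3 * gen3)].
Proof.
rewrite gen3_sqr; case: g => [[|[|[|//]]] lt]; [constructor 3|constructor 1|constructor 2];
by apply/val_inj; rewrite /= !inordK.
Qed.

Lemma gen3_spread (S : groupType) (f : {multiplicative C3 -> S}) K :
  subgroup K -> K (f gen3) -> forall g, K (f g).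
Proof.
move=> /subgroupP[_ KM _] Kg g.
have Kgg : K (f (gen3 * gen3)) by rewrite gmulfM; exact: KM.
by have [->|->|->] := gen3P g; rewrite // gmulfM; exact: KM.
Qed.

Lemma extended_ample t : ample extended (inr t).
Proof.
exists gen3, (inord 2 : 'I_3); split; first exact: gen3_neq1.
  by move/(congr1 val); rewrite /= inordK.
by move/(congr1 val); rewrite /= !inordK.
Qed.
End Extension.

Theorem theoremA (I : Type) (H : I -> groupType)
    (I_countable : countable [set: I])
    (I_ge2 : `I_2 #<= [set: I])
    (H_countable : forall i : I, countable [set: H i])
    (H_nontrivial : forall i : I, exists x : H i, x <> 1)
    (H_ge3 : exists i : I, `I_3 #<= [set: H i]) :
  exists S : groupType,
    [/\ simple_group S,
        exists a b : S, generates [set a; b]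
      & exists phi : forall i : I, {multiplicative H i -> S},
          (forall i : I, injective (phi i)) /\
          (forall i j : I, i <> j -> `I_3 #<= [set: H j] ->
             generates (range (phi i) `|` range (phi j)))].
Proof.
have [enc enc_inj] : exists enc : letter (extended H) -> nat, injective enc.
  apply: countable_letters => [|[i|t]]; [|exact: H_countable|exact: countableP].
  have /countable_injP[f f_inj] := I_countable.
  apply/countable_injP; exists (fun j => match j with inl i => (f i).*2 | inr t => (val t).*2.+1 end).
  move=> [i|t] [i'|t'] _ _ /= e.
  - by congr inl; apply: f_inj; rewrite ?in_setT //; lia.
  - by lia.
  - by lia.
  - by congr inr; apply/val_inj => /=; lia.
have inr_inj : injective (@inr I 'I_3) by move=> a b [].
have [S [phi [simpleS phi_inj gen]]] :=
  simple_embedding enc_inj (leqnn 2000) inr_inj (extended_ample H).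
exists S; split=> //; last first.
  exists (fun i => phi (inl i)); split=> [i|i j ij H3]; first by move=> a b; exact: (phi_inj (inl i)).
  apply: generatesI => K sK AK.
  have [x x1] := H_nontrivial i.
  apply: (gen K (inl i) (inl j) x) => //.
  - by case.
  - have [y [z yz]] := ample_card H3; by exists y, z.
  - by move=> a; apply: AK; left; exists a.
  - by move=> b; apply: AK; right; exists b.
exists (phi (inr ord0) gen3), (phi (inr ord_max) gen3).
apply: generatesI => K sK AK.
apply: (gen K (inr ord0) (inr ord_max) gen3) => //.
- exact: gen3_neq1.
- exact: extended_ample.
- exact: (@gen3_spread S (phi (inr ord0)) K sK (AK _ (or_introl erefl))).
- exact: (@gen3_spread S (phi (inr ord_max)) K sK (AK _ (or_intror erefl))).
Qed.
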